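(* Let $(\rho,u)$ be the solution on $[\sigma_\ell,\sigma_p]$ of the intermediate-zone system, let $p(x)=s_1\rho(x)^{\gamma_u}$, and let $$\mathcal F_r(x)=\frac12 u(x)^2+\frac{1}{\gamma_b-1}\,x\,u(x)+\Bigl(\frac{\gamma_u}{\gamma_u-1}-\frac{\gamma_b}{\gamma_b-1}\,\frac{x}{x-u(x)}\Bigr)\frac{p(x)}{\rho(x)}+Q .$$ Then the function $\mathcal F_r$ is defined and continuously differentiable over $(\sigma_\ell,\sigma_p]$, $\mathcal F_r(\sigma_p)>0$ and $\lim_{x\to\sigma_\ell^+}\mathcal F_r(x)=-\infty$. Consequently, the set $\mathcal S_r=\{x\in(\sigma_\ell,\sigma_p)\ :\ \mathcal F_r(x)=0\}$ is a non-empty closed subset of $(\sigma_\ell,\sigma_p)$ which admits a maximal element $\sigma_r$.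
   Context: Data: real numbers $\gamma_u>1$, $\gamma_b>1$ (heat capacity ratios of the unburnt and burnt gases), $Q>0$, $\rho_0>0$, $p_0>0$; $c_0=(\gamma_u p_0/\rho_0)^{1/2}$; a precursor shock speed $\sigma_p>c_0$, with $M_p=\sigma_p/c_0>1$. The state $(\rho_1,u_1,p_1)$ behind the precursor shock is $$\rho_1=\frac{\gamma_u+1}{\gamma_u-1+2/M_p^2}\,\rho_0,\quad u_1=\Bigl(1-\frac{\rho_0}{\rho_1}\Bigr)\sigma_p,\quad p_1=p_0+\Bigl(1-\frac{\rho_0}{\rho_1}\Bigr)\rho_0\,\sigma_p^2,$$ and $s_1=p_1/\rho_1^{\gamma_u}$. Given a function $\rho\ge 0$, $c(x)\ge 0$ is defined by $c(x)^2=\gamma_u s_1\,\rho(x)^{\gamma_u-1}$. The intermediate-zone system is $$\rho'(x)=-\frac{2u(x)\,(u(x)-x)}{x\bigl((u(x)-x)^2-c(x)^2\bigr)}\,\rho(x),\qquad u'(x)=\frac{2c(x)^2}{x\bigl((u(x)-x)^2-c(x)^2\bigr)}\,u(x),$$ with $\rho(\sigma_p)=\rho_1$ and $u(\sigma_p)=u_1$. For $\sigma\in[0,\sigma_p)$, a solution on $[\sigma,\sigma_p]$ is a pair $(\rho,u)$ of real functions, continuous on $[\sigma,\sigma_p]$ and continuously differentiable at all $x>0$ of this interval, with $\rho\ge0$, such that $(u(x)-x)^2-c(x)^2\ne 0$ and the two differential equations hold at each $x>0$ in $[\sigma,\sigma_p]$, and such that the conditions at $\sigma_p$ hold. $\sigma_\ell$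 is the smallest real number (infimum) of the set of $\sigma\in[0,\sigma_p)$ for which there is a solution on $[\sigma,\sigma_p]$ satisfying $0\le u(x)\le x$ and $\rho(x)\ge 0$ for all $x\in[\sigma,\sigma_p]$. There is exactly one solution on $[\sigma_\ell,\sigma_p]$, and it satisfies $0\le u(x)\le x$ there.
   Formalization: F_r(σ_p)>0, non-emptiness of S_r and existence of σ_r are proved under the added condition Q+(γ_u/(γ_u-1)-γ_b/(γ_b-1))p_0/ρ_0>0; this quantity equals F_r(σ_p), and Q>0 alone does not make it positive (e.g. γ_u=2, γ_b=1.1, Q=0.001, p_0=ρ_0=1). *)

(* Defs.v *)
From HB Require Import structures.
From mathcomp Require Import all_boot all_order all_algebra.
From mathcomp Require Import all_classical all_reals all_analysis.

Set Implicit Arguments.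
Unset Strict Implicit.
Unset Printing Implicit Defensive.

Import Order.TTheory GRing.Theory Num.Theory.
Import numFieldNormedType.Exports.

Local Open Scope classical_set_scope.
Local Open Scope ring_scope.

(* Throughout, gu and gb are the heat capacity ratios of the unburnt and burnt
   gases, (rho0, p0) the density and pressure at rest, and sp the speed of the
   precursor shock. *)

(* [f' x] is the derivative at [x] of the restriction of [f] to [A]: at an end
   point of an interval [A] this is the one-sided derivative. *)
Definition derivative_within (R : realType) (A : set R) (f : R -> R) (x l : R)
  : Prop := (f y - f x) / (y - x) @[y --> within A x^'] --> l.

Definition C1_with (R : realType) (A : set R) (f f' : R -> R) : Prop :=
  (forall x, A x -> derivative_within A f x (f' x)) /\
  {within A, continuous f'}.

Definition C1_on (R : realType) (A : set R) (f : R -> R) : Prop :=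
  exists f' : R -> R, C1_with A f f'.

Definition sound_speed0 (R : realType) (gu rho0 p0 : R) : R :=
  Num.sqrt (gu * p0 / rho0).

Definition mach_p (R : realType) (gu rho0 p0 sp : R) : R :=
  sp / sound_speed0 gu rho0 p0.

Definition rho1 (R : realType) (gu rho0 p0 sp : R) : R :=
  (gu + 1) / (gu - 1 + 2 / mach_p gu rho0 p0 sp ^+ 2) * rho0.

Definition u1 (R : realType) (gu rho0 p0 sp : R) : R :=
  (1 - rho0 / rho1 gu rho0 p0 sp) * sp.

Definition p1 (R : realType) (gu rho0 p0 sp : R) : R :=
  p0 + (1 - rho0 / rho1 gu rho0 p0 sp) * rho0 * sp ^+ 2.

Definition s1 (R : realType) (gu rho0 p0 sp : R) : R :=
  p1 gu rho0 p0 sp / rho1 gu rho0 p0 sp `^ gu.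

(* Here and below [r] is the density function; [powR] satisfies [0 `^ a = 0]
   for [a != 0], the convention needed where the density vanishes. *)
Definition sound_speed (R : realType) (gu rho0 p0 sp : R) (r : R -> R) (x : R)
  : R := Num.sqrt (gu * s1 gu rho0 p0 sp * r x `^ (gu - 1)).

Definition pressure (R : realType) (gu rho0 p0 sp : R) (r : R -> R) (x : R)
  : R := s1 gu rho0 p0 sp * r x `^ gu.

Definition sonic (R : realType) (gu rho0 p0 sp : R) (r u : R -> R) (x : R) : R :=
  (u x - x) ^+ 2 - sound_speed gu rho0 p0 sp r x ^+ 2.

Definition is_solution (R : realType) (gu rho0 p0 sp s : R) (r u : R -> R)
  : Prop :=
  let A := [set x : R | s <= x <= sp /\ 0 < x] in
  [/\ {within `[s, sp], continuous r} /\ {within `[s, sp], continuous u},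
      forall x, s <= x <= sp -> 0 <= r x,
      forall x, A x -> sonic gu rho0 p0 sp r u x != 0,
      exists r' u' : R -> R,
        [/\ C1_with A r r', C1_with A u u',
            forall x, A x ->
              r' x = - (2 * u x * (u x - x)
                        / (x * sonic gu rho0 p0 sp r u x)) * r x
          & forall x, A x ->
              u' x = 2 * sound_speed gu rho0 p0 sp r x ^+ 2
                     / (x * sonic gu rho0 p0 sp r u x) * u x]
    & r sp = rho1 gu rho0 p0 sp /\ u sp = u1 gu rho0 p0 sp].

Definition admissible_speeds (R : realType) (gu rho0 p0 sp : R) : set R :=
  [set s | 0 <= s < sp /\
     exists r u : R -> R, is_solution gu rho0 p0 sp s r u /\
       forall x, s <= x <= sp -> 0 <= u x <= x /\ 0 <= r x].

Definition Fr (R : realType) (gu gb Q rho0 p0 sp : R) (r u : R -> R) (x : R)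
  : R :=
  2^-1 * u x ^+ 2 + (gb - 1)^-1 * x * u x
  + (gu / (gu - 1) - gb / (gb - 1) * (x / (x - u x)))
    * (pressure gu rho0 p0 sp r x / r x)
  + Q.

Definition Sr (R : realType) (gu gb Q rho0 p0 sp sl : R) (r u : R -> R)
  : set R :=
  [set x | sl < x < sp /\ Fr gu gb Q rho0 p0 sp r u x = 0].

(* Main.v *)
Require Import Defs.
From HB Require Import structures.
From mathcomp Require Import all_boot all_order all_algebra.
From mathcomp Require Import all_classical all_reals all_analysis.
From mathcomp Require Import ring lra.

Set Implicit Arguments.
Unset Strict Implicit.
Unset Printing Implicit Defensive.

Import Order.TTheory GRing.Theory Num.Theory.
Import numFieldNormedType.Exports.

Local Open Scope classical_set_scope.
Local Open Scope ring_scope.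

(** Along any solution the flow is subsonic relative to the shock frame: the
sonic function is continuous, never zero, and negative just behind the
precursor shock.  The equation for the density is linear in the density and
that for the velocity is linear in the velocity, so neither can vanish
(Gronwall), and the signs of the right-hand sides then make the velocity
nonincreasing in x.  Going down from the shock, u grows while x shrinks, so
admissible speeds are bounded below by u1, whence 0 < u1 <= sl.

The heart of the proof is that u(sl) = sl and u(x) < x above sl.  Admissible
speeds exist arbitrarily close to sl, and by uniqueness for the initial value
problem their solutions coincide with (r, u); this gives u(x) <= x on
(sl, sp], and strictness follows from monotonicity.  If u(sl) < sl held, the
solution could be continued a little below sl while keeping u < x, and sl would
not be a lower bound of the admissible speeds.

Uniqueness and continuation need an existence and uniqueness theorem.  On a
compact interval of positive x, a solution stays in a region where all
quantities are bounded and the denominators are bounded away from zero.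
Clamping the variables to such a region turns the system into an autonomous
bounded Lipschitz field, with x itself as a third unknown.  For such fields
Picard iteration converges on the whole interval: in the norm weighted by
exp(2C(b - t)) integration of a C-Lipschitz field halves distances
([contraction_step]), which gives [solves_unique] and [solves_exists].  A
solution of the clamped system solves the original one as long as it stays in
the region, which yields [solution_unique] and [solution_extends].

Since x - u(x) decreases to 0 at sl while x, r(x) and the pressure keep positive
limits, the term with factor x / (x - u) drives Fr to -oo.  The
Rankine-Hugoniot relations evaluate Fr at sp.  When that value is positive, the
intermediate value theorem gives a zero, and all zeros lie in a compact interval
[d, sp] on which Fr is continuous, so that there is a largest one. *)

(** * Functions of one real variable *)

Lemma is_derive_continuous (R : realType) (f : R -> R) (x l : R) :
  is_derive x 1 f l -> {for x, continuous f}.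
Proof.
by move=> [df _]; apply: differentiable_continuous; exact/derivable1_diffP.
Qed.

Lemma nonincreasing_is_derive (R : realType) (f f' : R -> R) (a b x y : R) :
  {within `[a, b], continuous f} ->
  (forall t, a < t < b -> is_derive t 1 f (f' t)) ->
  (forall t, a < t < b -> f' t <= 0) ->
  a <= x -> x <= y -> y <= b -> f y <= f x.
Proof.
move=> cf df f'le ax xy yb.
have dab t : t \in `]a, b[%R -> is_derive t 1 f (f' t).
  by rewrite in_itv/= => /df.
apply: (@ler0_derive1_le_cc _ f a b) => //; last 2 first.
- by rewrite in_itv/= (le_trans ax xy).
- by rewrite in_itv/= ax (le_trans xy yb).
- by move=> t /dab[].
- move=> t tab; have [_ fE] := dab _ tab.
  by rewrite derive1E fE f'le//; move: tab; rewrite in_itv.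
Qed.

Lemma within_continuous_lipschitz (R : realType) (A : set R) (f : R -> R) (C : R) :
  (forall x y, A x -> A y -> `|f x - f y| <= C * `|x - y|) ->
  {within A, continuous f}.
Proof.
move=> fC; apply/subspace_continuousP => x Ax.
apply/cvgrPdist_lt => e e0; rewrite near_withinE.
exists (e / (`|C| + 1)) => /=; first by rewrite divr_gt0// ltr_wpDl.
move=> y /= xy Ay; apply: (le_lt_trans (fC _ _ Ax Ay)).
move: xy; rewrite ltr_pdivlMr ?ltr_wpDl// => xy.
have := ler_norm C; have := normr_ge0 C; have := normr_ge0 (x - y); nra.
Qed.

Lemma continuous_lipschitz (R : realType) (f : R -> R) (C : R) :
  (forall x y, `|f x - f y| <= C * `|x - y|) -> continuous f.
Proof.
move=> fC x; have : {within setT, continuous f}.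
  by apply: (@within_continuous_lipschitz _ _ _ C) => *.
by rewrite continuous_open_subspace; [apply; rewrite inE|exact: openT].
Qed.

Lemma lipschitz_is_derive (R : realType) (a b C : R) (f f' : R -> R) :
  {within `[a, b], continuous f} ->
  (forall t, a < t < b -> is_derive t 1 f (f' t)) ->
  (forall t, a < t < b -> `|f' t| <= C) ->
  forall s t, a <= s <= b -> a <= t <= b -> `|f s - f t| <= C * `|s - t|.
Proof.
move=> cf df bf' s t.
wlog st : s t / s < t.
  move=> h sI tI; have [/h|/h|->] := ltgtP s t; first exact.
    by rewrite distrC (distrC t); apply.
  by rewrite !subrr normr0 mulr0.
move=> /andP[as_ _] /andP[_ tb]; rewrite distrC (distrC s).
have sub x : x \in `]s, t[%R -> a < x < b.
  by rewrite in_itv/= => /andP[sx xt]; rewrite (le_lt_trans as_ sx) (lt_le_trans xt tb).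
have [|c /sub cab ->] := @MVT R f f' s t st (fun x xs => df _ (sub _ xs)).
  by apply: continuous_subspaceW cf; apply: subset_itv; rewrite bnd_simp.
by rewrite normrM ler_wpM2r// bf'.
Qed.

Lemma within_continuousM (R : realType) (A : set R) (f g : R -> R) :
  {within A, continuous f} -> {within A, continuous g} ->
  {within A, continuous (f * g)}.
Proof. by move=> cf cg x; apply: cvgM; [exact: cf|exact: cg]. Qed.

Lemma within_continuousV (R : realType) (A : set R) (f : R -> R) :
  (forall x, A x -> f x != 0) -> {within A, continuous f} ->
  {within A, continuous (fun x => (f x)^-1)}.
Proof.
move=> f0 /subspace_continuousP cf; apply/subspace_continuousP => x Ax.
by apply: cvgV; [exact: f0|exact: cf].
Qed.

Lemma within_continuous_id (R : realType) (A : set R) :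
  {within A, continuous (@id R)}.
Proof. by apply: continuous_subspaceT => x; exact: cvg_id. Qed.

Lemma within_continuous_cst (R : realType) (A : set R) (c : R) :
  {within A, continuous (fun=> c : R)}.
Proof. by move=> x; exact: cvg_cst. Qed.

(** The base may vanish: with a positive exponent, [powR] is continuous from
the right at 0, which is what a nonnegative density needs. *)
Lemma within_continuous_powR (R : realType) (A : set R) (f : R -> R) (a : R) :
  0 < a -> (forall x, A x -> 0 <= f x) -> {within A, continuous f} ->
  {within A, continuous (fun x => f x `^ a)}.
Proof.
move=> a0 f0 /subspace_continuousP cf.
have cpow : {within `[0, +oo[, continuous (@powR R ^~ a)}.
  apply/continuous_within_itvcyP; split=> [x|]; last first.
    by rewrite powR0 ?gt_eqF//; exact: powR_cvg0.
  rewrite in_itv/= andbT => x0; exact: is_derive_continuous (is_derive1_powR a x0).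
apply/subspace_continuousP => x Ax.
have fD y : A y -> (`[0, +oo[%classic : set R) (f y).
  by move=> Ay; rewrite /= in_itv/= andbT f0.
apply: (@cvg_comp _ _ _ f (@powR R ^~ a) _ (within `[0, +oo[ (nbhs (f x)))).
  move=> U DU; have := cf _ Ax _ DU; rewrite /nbhs/= /within/=.
  by apply: filterS => y h Ay; apply: h => //; exact: fD.
by move/subspace_continuousP : cpow; apply; exact: fD.
Qed.

Lemma nonvanishing_gt0 (R : realType) (f : R -> R) (a b : R) :
  {within `[a, b], continuous f} -> (forall t, a <= t <= b -> f t != 0) ->
  0 < f b -> forall t, a <= t <= b -> 0 < f t.
Proof.
move=> cf f0 fb t /andP[at_ tb]; rewrite ltNge; apply/negP => ft.
have [||c] := @IVT R f t b 0 tb.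
- by apply: continuous_subspaceW cf; apply: subset_itv; rewrite bnd_simp.
- by rewrite ge_min ft/= le_max (ltW fb) orbT.
- rewrite in_itv/= => /andP[tc cb] /eqP; apply/negP/f0.
  by rewrite (le_trans at_ tc).
Qed.

Lemma positive_bounded_below (R : realType) (f : R -> R) (a b : R) :
  {within `[a, b], continuous f} -> (forall t, a <= t <= b -> 0 < f t) ->
  exists e, 0 < e /\ forall t, a <= t <= b -> e <= f t.
Proof.
move=> cf f0; have [ab|ba] := leP a b; last first.
  by exists 1; split => // t /andP[at_ /(le_trans at_)]; rewrite leNgt ba.
have [c] := EVT_min ab cf; rewrite in_itv/= => cab cmin.
by exists (f c); split => [|t tab]; [exact: f0|apply: cmin; rewrite in_itv].
Qed.

Lemma within_continuous_bounded (R : realType) (f : R -> R) (a b : R) :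
  {within `[a, b], continuous f} ->
  exists K, forall t, a <= t <= b -> `|f t| <= K.
Proof.
move=> cf; have [ab|ba] := leP a b; last first.
  by exists 1 => t /andP[at_ /(le_trans at_)]; rewrite leNgt ba.
have [c _ cmin] := EVT_min ab cf; have [d _ dmax] := EVT_max ab cf.
exists (`|f c| + `|f d|) => t tab.
have := cmin t; have := dmax t; rewrite in_itv/= => /(_ tab) + /(_ tab).
have := ler_norm (f d); have := ler_norm (- f c); rewrite normrN ler_norml.
by have := normr_ge0 (f c); have := normr_ge0 (f d) => *; apply/andP; split; lra.
Qed.

(** Multiplying by [expR (- K * t)] makes [f] nonincreasing, so that
positivity at the right end propagates to the left. *)
Lemma gronwall_gt0 (R : realType) (f f' : R -> R) (a b K : R) :
  {within `[a, b], continuous f} ->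
  (forall t, a < t < b -> is_derive t 1 f (f' t)) ->
  (forall t, a < t < b -> f' t <= K * f t) ->
  0 < f b -> forall t, a <= t <= b -> 0 < f t.
Proof.
move=> cf df f'K fb t /andP[at_ tb].
pose w s := expR (- K * s).
have dw (s : R) : is_derive s 1 w (- K * w s).
  by rewrite /w; apply: is_derive_eq; rewrite /GRing.scale/=; lra.
have cw : {within `[a, b], continuous w}.
  by apply: continuous_subspaceT => s; exact: is_derive_continuous (dw s).
have : (f * w) b <= (f * w) t.
  apply: (@nonincreasing_is_derive R (f * w)
    (fun s => f s *: (- K * w s) + w s *: f' s) a b) => //.
  - exact: within_continuousM.
  - by move=> s /df ds; apply: is_deriveM.
  - move=> s /f'K fs; rewrite /GRing.scale/=.
    by have := expR_gt0 (- K * s); rewrite -/(w s); nra.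
have wt : 0 < w t by exact: expR_gt0.
have wb : 0 < w b by exact: expR_gt0.
by rewrite !fctE => /(lt_le_trans (mulr_gt0 fb wb)); rewrite pmulr_lgt0.
Qed.

Lemma is_derive_integral (R : realType) (f : R -> R) (a x : R) :
  continuous f -> a < x ->
  is_derive x 1 (fun y => \int[@lebesgue_measure R]_(t in `[a, y]) f t) (f x).
Proof.
move=> cf ax.
have [||dF F'] := @continuous_FTC1_closed R f a x (x + 1) _ _ ax (cf x).
- by rewrite ltrDl.
- apply: continuous_compact_integrable; first exact: segment_compact.
  exact: continuous_subspaceT.
- by split; [exact: dF|rewrite -derive1E F'].
Qed.

Lemma powR_lipschitz (R : realType) (a lo hi : R) : 0 < lo -> lo <= hi ->
  exists L, forall s t, lo <= s <= hi -> lo <= t <= hi ->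
    `|s `^ a - t `^ a| <= L * `|s - t|.
Proof.
move=> lo0 lohi.
have cpow b : {within `[lo, hi], continuous (@powR R ^~ b)}.
  apply: continuous_in_subspaceT => x; rewrite inE/= in_itv/= => /andP[lox _].
  exact: is_derive_continuous (is_derive1_powR b (lt_le_trans lo0 lox)).
have [c _ cmax] := EVT_max lohi (cpow (a - 1)).
exists (`|a| * c `^ (a - 1)).
apply: (@lipschitz_is_derive R lo hi _ (@powR R ^~ a)
  (fun x => a * x `^ (a - 1)) (cpow a)) => // x /andP[lox xhi].
- by apply: is_derive1_powR; exact: lt_trans lox.
- by rewrite normrM ler_wpM2l// ger0_norm ?powR_ge0// cmax// in_itv/= !ltW.
Qed.

(** The zeros in [a, b] form a nonempty compact set. *)
Lemma exists_largest_zero (R : realType) (f : R -> R) (a b : R) :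
  {within `[a, b], continuous f} -> a <= b -> f a < 0 -> 0 < f b ->
  exists c, [/\ a < c < b, f c = 0 & forall x, a <= x <= b -> f x = 0 -> x <= c].
Proof.
move=> cf ab fa fb.
pose Z := f @^-1` [set 0] `&` `[a, b].
have cZ : compact Z.
  apply: (subclosed_compact _ (@segment_compact R a b)); last by move=> x [].
  rewrite closed_setIS; last exact: interval_closed.
  by apply: (continuous_closedP _).1 cf _ _; exact: closed_eq.
have Z0 : Z !=set0.
  have [|c cab fc0] := @IVT R f a b 0 ab cf.
    by rewrite ge_min (ltW fa)/= le_max (ltW fb) orbT.
  by exists c.
have [c] := compact_EVT_max Z0 cZ (@within_continuous_id R Z).
rewrite inE => -[/= fc0]; rewrite in_itv/= => /andP[ac cb] cmax.
exists c; split=> // [|x xab fx0]; last first.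
  by apply: cmax; rewrite inE; split => //=; rewrite in_itv.
rewrite !lt_neqAle ac cb !andbT; apply/andP; split; apply/eqP => E.
  by move: fa; rewrite E fc0 ltxx.
by move: fb; rewrite -E fc0 ltxx.
Qed.

(** * Derivatives relative to a set *)

Lemma derivative_within_is_derive (R : realType) (A : set R) (f : R -> R) (x l : R) :
  nbhs x A -> derivative_within A f x l -> is_derive x 1 f l.
Proof.
move=> xA /cvgrPdist_lt dfx.
suff h : h^-1 *: ((f \o shift x) (h *: (1 : R)) - f x) @[h --> 0^'] --> l.
  by split; [apply/cvg_ex; exists l|apply/cvg_lim].
apply/cvgrPdist_lt => e /dfx; rewrite near_withinE => -[d /= d0 dP].
move: xA => [d' /= d'0 d'P].
exists (Num.min d d') => /=; first by rewrite lt_min d0.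
move=> h /=; rewrite sub0r normrN lt_min => /andP[hd hd'] h0.
have xh : `|x - (h + x)| = `|h| by rewrite opprD addrCA subrr addr0 normrN.
have := dP (h + x); rewrite /ball_/= xh => /(_ hd).
have -> : (h + x != x) by rewrite -subr_eq0 addrK.
move=> /(_ isT (d'P _ _)); rewrite /= xh addrK => /(_ hd').
by rewrite /GRing.scale/= mulr1 mulrC.
Qed.

Lemma is_derive_derivative_within (R : realType) (A : set R) (f : R -> R) (x l : R) :
  is_derive x 1 f l -> derivative_within A f x l.
Proof.
move=> [+ fl]; rewrite /derivable => /cvg_ex[l' dfx].
have ll : l' = l by rewrite -fl; apply/esym/cvg_lim.
rewrite ll in dfx; move/cvgrPdist_lt : dfx => dfx.
apply/cvgrPdist_lt => e /dfx[d /= d0 dP]; rewrite near_withinE.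
exists d => //= y xy yx Ay.
have := dP (y - x); rewrite /= sub0r normrN distrC => /(_ xy).
by rewrite subr_eq0 /GRing.scale/= mulr1 subrK mulrC; apply.
Qed.

Section derivative_within_calculus.
Variables (R : realType) (A : set R).
Implicit Types (f g phi : R -> R) (x l : R).

Lemma derivative_within_cvg f x l : derivative_within A f x l ->
  f y @[y --> within A x^'] --> f x.
Proof.
move=> dfx.
have h : (f y - f x) / (y - x) * (y - x) + f x @[y --> within A x^']
    --> l * (x - x) + f x.
  apply: cvgD; last exact: cvg_cst.
  apply: cvgM => //; apply: cvgB; last exact: cvg_cst.
  by apply: cvg_within_filter; apply: cvg_within_filter; exact: cvg_id.
rewrite subrr mulr0 add0r in h; apply: cvg_trans h; apply: near_eq_cvg.
rewrite near_withinE near_withinE; apply: nearW => y yx _.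
by rewrite divfK ?subr_eq0// subrK.
Qed.

Lemma derivative_withinD f g x l l' : derivative_within A f x l ->
  derivative_within A g x l' -> derivative_within A (f + g) x (l + l').
Proof.
move=> df dg; rewrite /derivative_within.
rewrite [X in X @ _](_ : _ = (fun y => (f y - f x) / (y - x)) +
    (fun y => (g y - g x) / (y - x))); first exact: cvgD.
by apply/funext => y; rewrite !fctE -mulrDl opprD addrACA.
Qed.

Lemma derivative_withinM f g x l l' : derivative_within A f x l ->
  derivative_within A g x l' ->
  derivative_within A (f * g) x (l * g x + f x * l').
Proof.
move=> df dg; rewrite /derivative_within.
rewrite [X in X @ _](_ : _ = (fun y => (f y - f x) / (y - x)) * g +
    (fun=> f x) * (fun y => (g y - g x) / (y - x))).
  apply: cvgD; apply: cvgM => //; last exact: cvg_cst.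
  exact: derivative_within_cvg dg.
by apply/funext => y; rewrite !fctE; ring.
Qed.

(** Caratheodory's form of differentiability makes the difference quotient
of a composition a product, even where [f y = f x]. *)
Lemma derivative_within_comp phi f x l l' : derivative_within A f x l ->
  is_derive (f x) 1 phi l' -> derivative_within A (phi \o f) x (l' * l).
Proof.
move=> df /is_derive1_caratheodory[g [gE gc gl]].
rewrite /derivative_within.
rewrite [X in X @ _](_ : _ = (g \o f) * (fun y => (f y - f x) / (y - x))).
  rewrite -gl; apply: cvgM => //.
  by apply: continuous_cvg => //; exact: derivative_within_cvg df.
by apply/funext => y; rewrite !fctE/= gE mulrA.
Qed.

Lemma C1_on_continuous f : C1_on A f -> {within A, continuous f}.
Proof.
move=> [f' [df _]]; apply/subspace_continuousP => x Ax.
have := derivative_within_cvg (df x Ax).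
move=> /cvgrPdist_lt h; apply/cvgrPdist_lt => e e0.
have := h _ e0; rewrite !near_withinE => -[d /= d0 dP]; exists d => //= y xy Ay.
have [->|yx] := eqVneq y x; first by rewrite subrr normr0.
exact: dP.
Qed.

Lemma C1_on_cst (c : R) : C1_on A (fun=> c).
Proof.
exists (fun=> 0); split=> [x _|]; last exact: within_continuous_cst.
by apply: is_derive_derivative_within; exact: is_derive_cst.
Qed.

Lemma C1_on_id : C1_on A id.
Proof.
exists (fun=> 1); split=> [x _|]; last exact: within_continuous_cst.
by apply: is_derive_derivative_within; exact: is_derive_id.
Qed.

Lemma C1_onD f g : C1_on A f -> C1_on A g -> C1_on A (f + g).
Proof.
move=> [f' [df cf]] [g' [dg cg]]; exists (f' + g'); split.
  by move=> x Ax; apply: derivative_withinD; [exact: df|exact: dg].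
exact: within_continuousD.
Qed.

Lemma C1_onM f g : C1_on A f -> C1_on A g -> C1_on A (f * g).
Proof.
move=> Cf Cg; have cf0 := C1_on_continuous Cf; have cg0 := C1_on_continuous Cg.
move: Cf Cg => [f' [df cf]] [g' [dg cg]]; exists (f' * g + f * g'); split.
  by move=> x Ax; apply: derivative_withinM; [exact: df|exact: dg].
by apply: within_continuousD; exact: within_continuousM.
Qed.

Lemma C1_on_comp phi phi' f : C1_on A f ->
  (forall x, A x -> is_derive (f x) 1 phi (phi' (f x))) ->
  {within A, continuous (phi' \o f)} -> C1_on A (phi \o f).
Proof.
move=> [f' [df cf]] dphi cphi; exists ((phi' \o f) * f'); split.
  by move=> x Ax; apply: derivative_within_comp; [exact: df|exact: dphi].
exact: within_continuousM.
Qed.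

Lemma C1_onN f : C1_on A f -> C1_on A (- f).
Proof.
move=> Cf; have -> : - f = (fun=> -1) * f.
  by apply/funext => x; rewrite !fctE mulN1r.
by apply: C1_onM => //; exact: C1_on_cst.
Qed.

Lemma C1_onV f : (forall x, A x -> f x != 0) -> C1_on A f ->
  C1_on A (fun x => (f x)^-1).
Proof.
move=> f0 Cf; apply: (@C1_on_comp GRing.inv (fun z => - z ^- 2)) => //.
  move=> x /f0 fx0; have did : derivable (@id R) (f x) 1 by exact: derivable_id.
  split; first exact: (derivableV fx0 did).
  by rewrite (deriveV fx0 did) derive_id /GRing.scale/= mulr1.
have cf := C1_on_continuous Cf.
have cV : {within A, continuous (fun x => (f x * f x)^-1)}.
  apply: within_continuousV; last exact: within_continuousM.
  by move=> x /f0; rewrite mulf_eq0 orbb.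
by move=> x; exact: cvgN (cV x).
Qed.

Lemma C1_on_powR f (a : R) : (forall x, A x -> 0 < f x) -> C1_on A f ->
  C1_on A (fun x => f x `^ a).
Proof.
move=> f0 Cf; apply: (@C1_on_comp (@powR R ^~ a) (fun z => a * z `^ (a - 1))) => //.
  by move=> x /f0; exact: is_derive1_powR.
apply: (@within_continuousM _ _ (fun=> a)); first exact: within_continuous_cst.
apply: (@within_continuous_comp _ _ _ A f (@powR R ^~ (a - 1))); last first.
  exact: C1_on_continuous.
move=> _ /[!inE] -[x Ax <-].
exact: is_derive_continuous (is_derive1_powR (a - 1) (f0 x Ax)).
Qed.

End derivative_within_calculus.

Lemma C1_on_subset (R : realType) (A B : set R) (f : R -> R) : B `<=` A ->
  C1_on A f -> C1_on B f.
Proof.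
move=> BA [f' [df cf]]; exists f'; split=> [x /BA Ax|].
  apply: cvg_trans (df x Ax) => U; rewrite /fmap /= /nbhs /= /within /=.
  by apply: filterS => y h yB; apply: h; exact: BA.
exact: continuous_subspaceW cf.
Qed.

(** * Uniqueness for bounded Lipschitz fields *)

(** The integral of the weight [expR (2 * C * (b - t))] from [t] to [b] is at most
its value at [t] divided by [2 * C], so integrating [C] times the weight gives at
most half of it.  The integration is done by comparing [f] with the weight
through monotonicity. *)
Lemma exp_weight_halves (R : realType) (a b C D : R) (f f' : R -> R) :
  0 <= D -> {within `[a, b], continuous f} ->
  (forall t, a < t < b -> is_derive t 1 f (f' t)) -> f b = 0 ->
  (forall t, a < t < b -> `|f' t| <= C * (D * expR (2 * C * (b - t)))) ->
  forall t, a <= t <= b -> `|f t| <= D / 2 * expR (2 * C * (b - t)).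
Proof.
move=> D0 cf df fb bf' t /andP[at_ tb].
pose w s := D / 2 * expR (2 * C * (b - s)).
have dw (s : R) : is_derive s 1 w (- (C * (D * expR (2 * C * (b - s))))).
  rewrite /w; apply: is_derive_eq; rewrite /GRing.scale/=; lra.
have cw : {within `[a, b], continuous w}.
  by apply: continuous_subspaceT => s; exact: is_derive_continuous (dw s).
have wb : w b = D / 2 by rewrite /w subrr mulr0 expR0 mulr1.
have ab : a <= t <= b by rewrite at_.
rewrite -/(w t) ler_norml; apply/andP; split.
- have := @nonincreasing_is_derive R (f + w)
    (fun s => f' s - C * (D * expR (2 * C * (b - s)))) a b t b.
  move=> /(_ _ _ _ at_ tb (lexx _)); rewrite !fctE wb fb => H.
  suff : 0 + D / 2 <= f t + w t by lra.
  apply: H.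
  + exact: within_continuousD.
  + by move=> s /df ds; apply: is_deriveD.
  + by move=> s /bf' /ler_normlP[]; lra.
- have := @nonincreasing_is_derive R (w - f)
    (fun s => - (C * (D * expR (2 * C * (b - s)))) - f' s) a b t b.
  move=> /(_ _ _ _ at_ tb (lexx _)); rewrite !fctE wb fb => H.
  suff : D / 2 - 0 <= w t - f t by lra.
  apply: H.
  + exact: within_continuousB.
  + by move=> s /df ds; apply: is_deriveB.
  + by move=> s /bf' /ler_normlP[]; lra.
Qed.

Lemma halves_le0 (R : realType) (D x : R) : (forall n, x <= D / 2 ^+ n) -> x <= 0.
Proof.
move=> xD; have h : D / 2 ^+ n @[n --> \oo] --> (0 : R).
  have : geometric D (2^-1) @ \oo --> (0 : R).
    by apply: cvg_geometric; rewrite ger0_norm ?invr_ge0// invf_lt1 ?ltr1n.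
  apply: cvg_trans; apply: near_eq_cvg; apply: nearW => n.
  by rewrite /geometric/= exprVn.
rewrite leNgt; apply/negP => x0; near \oo => n.
have := xD n; rewrite leNgt => /negP; apply.
near: n; exact: (cvgr_lt _ h _ x0).
Unshelve. all: by end_near. Qed.

(** The Lipschitz condition is for the supremum distance on [I -> R], phrased
with a common bound [d] on the coordinates so that no norm is needed and [I]
can be any type. *)
Definition bounded_lipschitz (R : realType) (I : Type) (C : R) (g : (I -> R) -> R) :=
  [/\ 0 <= C, forall y, `|g y| <= C &
    forall y z d, 0 <= d -> (forall i, `|y i - z i| <= d) -> `|g y - g z| <= C * d].

Definition solves (R : realType) (I : Type) (F : I -> (I -> R) -> R) (a b : R)
  (Y : I -> R -> R) :=
  forall i, {within `[a, b], continuous (Y i)} /\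
    forall t, a < t < b -> is_derive t 1 (Y i) (F i (Y^~ t)).

Section bounded_lipschitz_field.
Variables (R : realType) (I : Type) (F : I -> (I -> R) -> R) (C a b : R).
Hypothesis FC : forall i, bounded_lipschitz C (F i).
Implicit Types Y Z : I -> R -> R.

(** Distance at most [D] in the weighted supremum norm for which the Picard
operator is a contraction. *)
Definition exp_close (D : R) Y Z := forall i t, a <= t <= b ->
  `|Y i t - Z i t| <= D * expR (2 * C * (b - t)).

(** Replacing trajectories [Y], [Z] by primitives [U], [V] of the field along
them halves the weighted distance; fixed points are therefore unique, and
iterates converge geometrically, however long the interval. *)
Lemma contraction_step (D : R) Y Z (U V : I -> R -> R) : 0 <= D ->
  exp_close D Y Z ->
  (forall i, {within `[a, b], continuous (U i)} /\
    forall t, a < t < b -> is_derive t 1 (U i) (F i (Y^~ t))) ->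
  (forall i, {within `[a, b], continuous (V i)} /\
    forall t, a < t < b -> is_derive t 1 (V i) (F i (Z^~ t))) ->
  (forall i, U i b = V i b) ->
  exp_close (D / 2) U V.
Proof.
move=> D0 YZ dU dV UVb i t tab.
have [cU {}dU] := dU i; have [cV {}dV] := dV i.
apply: (@exp_weight_halves R a b C D (U i - V i)
  (fun s => F i (Y^~ s) - F i (Z^~ s))) tab => //.
- exact: within_continuousB.
- by move=> s sab; have := dU _ sab; have := dV _ sab => ? ?; apply: is_deriveB.
- by rewrite !fctE UVb subrr.
- move=> s /andP[/ltW as_ /ltW sb]; have [_ _] := FC i; apply.
    by rewrite mulr_ge0// expR_ge0.
  by move=> j; apply: YZ; rewrite as_.
Qed.

Lemma solves_lipschitz Y i s t : solves F a b Y ->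
  a <= s <= b -> a <= t <= b -> `|Y i s - Y i t| <= C * `|s - t|.
Proof.
move=> sY; have [cY dY] := sY i.
apply: (@lipschitz_is_derive _ a b C (Y i) (fun t => F i (Y^~ t)) cY dY).
by move=> x _; have [_ + _] := FC i; apply.
Qed.

(** Bounded fields give a first bound on the distance, and two solutions are
fixed points of the contraction. *)
Lemma solves_unique Y Z : solves F a b Y -> solves F a b Z ->
  (forall i, Y i b = Z i b) -> forall i t, a <= t <= b -> Y i t = Z i t.
Proof.
move=> sY sZ YZb i t /andP[at_ tb].
have C0 : 0 <= C by case: (FC i).
have ab : a <= b := le_trans at_ tb.
pose D := 2 * C * (b - a).
have D0 : 0 <= D by rewrite !mulr_ge0// subr_ge0.
have close_n n : exp_close (D / 2 ^+ n) Y Z.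
  elim: n => [|n IH].
    move=> j s sI; have /andP[as_ sb] := sI; rewrite expr0 divr1.
    have bI : a <= b <= b by rewrite ab lexx.
    have := solves_lipschitz j sZ sI bI; have := solves_lipschitz j sY sI bI.
    rewrite (distrC s) (ger0_norm (x := b - s)) ?subr_ge0// => h1 h2.
    have e1 : 1 <= expR (2 * C * (b - s)).
      by rewrite -expR0 ler_expR !mulr_ge0// subr_ge0.
    have h : `|Y j s - Z j s| <= D.
      move: h1 h2; rewrite YZb !ler_distl /D => /andP[? ?] /andP[? ?].
      apply/andP; split; nra.
    by apply: (le_trans h); rewrite ler_peMr.
  rewrite exprSr invfM mulrA; apply: contraction_step IH sY sZ YZb.
  by rewrite divr_ge0// exprn_ge0.
suff : `|Y i t - Z i t| <= 0 by rewrite normr_le0 subr_eq0 => /eqP.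
apply: (@halves_le0 _ (D * expR (2 * C * (b - t)))) => n.
rewrite mulrAC; apply: close_n; by rewrite at_.
Qed.

End bounded_lipschitz_field.

(** * Existence for bounded Lipschitz fields *)

(** The sequences [u n - 2 * c / 2 ^+ n] and [u n + 2 * c / 2 ^+ n] are
monotone and approach each other; the limit is the supremum of the former. *)
Lemma halving_limit (R : realType) (u : nat -> R) (c : R) :
  (forall n, `|u n.+1 - u n| <= c / 2 ^+ n) ->
  exists L, forall n, `|u n - L| <= 2 * c / 2 ^+ n.
Proof.
move=> uc; pose e n := 2 * c / 2 ^+ n.
have eS n : e n.+1 = e n - c / 2 ^+ n.
  by rewrite /e exprS invfM; lra.
have e0 n : 0 <= e n.
  by have := le_trans (normr_ge0 _) (uc n); rewrite /e -mulrA; lra.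
have lo k n : u n - e n <= u (n + k)%N - e (n + k)%N.
  elim: k => [|k IH]; first by rewrite addn0.
  by rewrite addnS eS; have := uc (n + k)%N; rewrite ler_norml; lra.
have hi k n : u (n + k)%N + e (n + k)%N <= u n + e n.
  elim: k => [|k IH]; first by rewrite addn0.
  by rewrite addnS eS; have := uc (n + k)%N; rewrite ler_norml; lra.
have lohi n m : u n - e n <= u m + e m.
  have [nm|/ltnW mn] := leqP n m.
  - rewrite -(subnKC nm); apply: (le_trans (lo (m - n)%N n)).
    by have := e0 (n + (m - n))%N; lra.
  - rewrite -(subnKC mn); apply: le_trans (hi (n - m)%N m).
    by have := e0 (m + (n - m))%N; lra.
pose S := [set u n - e n | n in setT].
have Sn n : S (u n - e n) by exists n.
have ubS n : ubound S (u n + e n) by move=> _ [m _ <-].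
have hS : has_sup S by split; [exists (u 0%N - e 0%N)|exists (u 0%N + e 0%N)].
exists (sup S) => n; rewrite ler_norml -/(e n); apply/andP; split.
- have : sup S <= u n + e n by apply: ge_sup => //; exists (u 0%N - e 0%N).
  by lra.
- have : u n - e n <= sup S by apply: ub_le_sup => //; exists (u 0%N + e 0%N).
  by lra.
Qed.

Definition clamp (R : realType) (lo hi x : R) : R := Num.max lo (Num.min x hi).

Lemma clamp_itv (R : realType) (lo hi x : R) :
  lo <= hi -> lo <= clamp lo hi x <= hi.
Proof. by move=> lohi; rewrite le_max lexx/= ge_max lohi ge_min lexx orbT. Qed.

Lemma clamp_id (R : realType) (lo hi x : R) : lo <= x <= hi -> clamp lo hi x = x.
Proof. by rewrite /clamp => /andP[lox xhi]; rewrite min_l// max_r. Qed.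

Lemma clamp_lipschitz (R : realType) (lo hi x y : R) :
  `|clamp lo hi x - clamp lo hi y| <= `|x - y|.
Proof.
wlog xy : x y / x <= y.
  by move=> h; have [/h//|/ltW/h] := leP x y; rewrite distrC (distrC y).
rewrite (distrC x) (distrC (clamp _ _ x)) (ger0_norm (x := y - x)) ?subr_ge0//.
rewrite ler_norml /clamp !minElt !maxElt.
by do ! case: ifPn; rewrite -?leNgt; move=> *; apply/andP; split; lra.
Qed.

Section picard.
Variables (R : realType) (I : Type) (F : I -> (I -> R) -> R) (C a b : R).
Variable y0 : I -> R.
Hypothesis FC : forall i, bounded_lipschitz C (F i).
Hypothesis ab : a <= b.

Definition lipschitz_on (Y : I -> R -> R) := forall i s t,
  a <= s <= b -> a <= t <= b -> `|Y i s - Y i t| <= C * `|s - t|.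

Let rhs (Y : I -> R -> R) i t := F i (fun j => Y j (clamp a b t)).

(* The primitive starts at [a - 1] so that [a] is an interior point of its
   domain of differentiability. *)
Let step (Y : I -> R -> R) i x :=
  y0 i + (\int[@lebesgue_measure R]_(t in `[a - 1, x]) rhs Y i t
          - \int[@lebesgue_measure R]_(t in `[a - 1, b]) rhs Y i t).

Let step_end Y i : step Y i b = y0 i.
Proof. by rewrite /step subrr addr0. Qed.

Let C0 : I -> 0 <= C.
Proof. by move=> i; case: (FC i). Qed.

Let step_derive Y i t : lipschitz_on Y -> a - 1 < t ->
  is_derive t 1 (step Y i) (rhs Y i t).
Proof.
move=> YL ta.
have crhs : continuous (rhs Y i).
  apply: (@continuous_lipschitz _ _ (C * C)) => x y; have [_ _ FL] := FC i.
  rewrite -mulrA; apply: FL => [|j]; first by rewrite mulr_ge0// C0.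
  apply: (le_trans (YL _ _ _ (clamp_itv _ ab) (clamp_itv _ ab))).
  by rewrite ler_wpM2l ?(C0 i)// clamp_lipschitz.
have := is_derive_integral crhs ta => dI.
rewrite -[rhs Y i t]add0r -[rhs Y i t]subr0; apply: is_deriveD.
Qed.

Let step_within Y i : lipschitz_on Y -> {within `[a, b], continuous (step Y i)}.
Proof.
move=> YL; apply/continuous_in_subspaceT => t; rewrite inE/= in_itv/= => /andP[at_ _].
by apply: is_derive_continuous (@step_derive Y i t YL _); lra.
Qed.

Let step_lipschitz Y : lipschitz_on Y -> lipschitz_on (step Y).
Proof.
move=> YL i; apply: (lipschitz_is_derive (f' := rhs Y i) (step_within YL)) => t.
- by move=> /andP[ax _]; apply: step_derive => //; lra.
- by move=> _; have [_ + _] := FC i; apply.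
Qed.

Let pic n := iter n step (fun i _ => y0 i).

Let pic_lipschitz n : lipschitz_on (pic n).
Proof.
elim: n => [i s t _ _|n IH]; last exact: step_lipschitz.
by rewrite /pic/= subrr normr0 mulr_ge0// C0.
Qed.

Let step_close D Y Z : 0 <= D -> lipschitz_on Y -> lipschitz_on Z ->
  exp_close C a b D Y Z -> exp_close C a b (D / 2) (step Y) (step Z).
Proof.
move=> D0 YL ZL YZ; apply: (contraction_step FC D0 YZ) => i.
- split=> [|t /andP[at_ tb]]; first exact: step_within.
  have := @step_derive Y i t YL; rewrite /rhs clamp_id ?ltW//.
  by apply; lra.
- split=> [|t /andP[at_ tb]]; first exact: step_within.
  have := @step_derive Z i t ZL; rewrite /rhs clamp_id ?ltW//.
  by apply; lra.
- by rewrite !step_end.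
Qed.

(** Picard iteration.  The limit [Y] of the iterates satisfies [step Y = Y] on
[a, b], and the values of [step Y] are differentiable from both sides, also
at the end points, because the field is extended past them by clamping time. *)
Lemma solves_exists : exists Y : I -> R -> R,
  (forall i, Y i b = y0 i) /\
  forall i t, a <= t <= b -> is_derive t 1 (Y i) (F i (Y^~ t)).
Proof.
have [[i0]|noI] := pselect (inhabited I); last first.
  by exists (fun _ _ => 0); split => i; case: noI.
have C0' := C0 i0.
pose D := C * (b - a).
have D0 : 0 <= D by rewrite mulr_ge0// subr_ge0.
have D0n n : 0 <= D / 2 ^+ n by rewrite divr_ge0// exprn_ge0.
have cauchy n : exp_close C a b (D / 2 ^+ n) (pic n.+1) (pic n).
  elim: n => [i t tab|n IH]; last first.
    by rewrite exprSr invfM mulrA; apply: step_close IH.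
  have /andP[at_ tb] := tab.
  have bb : a <= b <= b by rewrite ab lexx.
  have := @pic_lipschitz 1 i t b tab bb; rewrite /pic/= step_end => h.
  apply: (le_trans h); rewrite expr0 divr1 distrC ger0_norm ?subr_ge0//.
  apply: (@le_trans _ _ D); first by rewrite /D ler_wpM2l//; lra.
  by rewrite ler_peMr// -expR0 ler_expR !mulr_ge0// subr_ge0.
pose E t := expR (2 * C * (b - t)).
have lim i t : exists L, a <= t <= b ->
    forall n, `|pic n i t - L| <= 2 * (D * E t) / 2 ^+ n.
  have [tab|] := boolP (a <= t <= b); last by exists 0.
  have [n|L] := @halving_limit R (fun n => pic n i t) (D * E t).
    by rewrite mulrAC; apply: cauchy.
  by exists L.
pose Y i t := projT1 (cid (lim i t)).
have YP n : exp_close C a b (2 * D / 2 ^+ n) (pic n) Y.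
  move=> i t tab; rewrite /Y; case: cid => L /= /(_ tab n).
  by rewrite mulrA mulrAC.
have YL : lipschitz_on Y.
  move=> i s t sab tab; rewrite -subr_le0.
  apply: (@halves_le0 _ (2 * D * (E s + E t))) => n.
  have := YP n i s sab; have := YP n i t tab; have := pic_lipschitz n i sab tab.
  rewrite -!/(E _) !ler_norml => /andP[? ?] /andP[? ?] /andP[? ?].
  have : `|Y i s - Y i t| <= C * `|s - t| + 2 * D / 2 ^+ n * E s + 2 * D / 2 ^+ n * E t.
    by rewrite ler_norml; apply/andP; split; lra.
  by rewrite mulrAC mulrDr; lra.
have stepY i t : a <= t <= b -> step Y i t = Y i t.
  move=> tab; apply/eqP; rewrite -subr_eq0 -normr_le0.
  apply: (@halves_le0 _ (2 * D * E t)) => n.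
  have D2 : 0 <= 2 * D / 2 ^+ n by rewrite -mulrA mulr_ge0.
  have := step_close D2 (@pic_lipschitz n) YL (YP n) i tab.
  have := YP n.+1 i t tab.
  rewrite -!/(E _) exprS invfM /pic iterS -/(pic n) [X in _ -> _ -> _ <= X]mulrAC.
  rewrite !ler_norml => /andP[? ?] /andP[? ?].
  by apply/andP; split; lra.
exists (step Y); split => [i|i t tab]; first exact: step_end.
have -> : (step Y)^~ t = fun j => Y j (clamp a b t).
  by apply/funext => j; rewrite stepY// clamp_id.
apply: step_derive => //; lra.
Qed.

End picard.

(** * Building bounded Lipschitz functions *)

Section bounded_lipschitz_calculus.
Variables (R : realType) (I : Type).
Implicit Types (g h : (I -> R) -> R).

Lemma bounded_lipschitz_le (C D : R) g : C <= D ->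
  bounded_lipschitz C g -> bounded_lipschitz D g.
Proof.
move=> CD [C0 gC gL]; split=> [|y|y z d d0 yz].
- exact: le_trans CD.
- exact: le_trans CD.
- by apply: (le_trans (gL _ _ _ d0 yz)); rewrite ler_wpM2r.
Qed.

(** Functions that may be coordinates of a field to which the existence and
uniqueness theorems apply; the constant is left out to obtain a calculus. *)
Definition tempered g := exists C, bounded_lipschitz C g.

Lemma tempered_cst (c : R) : tempered (fun=> c).
Proof.
exists `|c|; split => // y z d d0 _.
by rewrite subrr normr0 mulr_ge0.
Qed.

Lemma tempered_clamp (lo hi : R) i : lo <= hi ->
  tempered (fun y => clamp lo hi (y i)).
Proof.
move=> lohi; exists (1 + `|lo| + `|hi|); split=> [|y|y z d d0 yz].
- by rewrite !addr_ge0.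
- have /andP[l h] := clamp_itv (y i) lohi.
  have := ler_norm (- lo); have := ler_norm hi; rewrite normrN ler_norml => *.
  by have := normr_ge0 lo; have := normr_ge0 hi; move=> *; apply/andP; split; lra.
- apply: (le_trans (clamp_lipschitz _ _ _ _)); apply: (le_trans (yz i)).
  by rewrite ler_peMl// -addrA lerDl addr_ge0.
Qed.

Lemma temperedD g h : tempered g -> tempered h -> tempered (fun y => g y + h y).
Proof.
move=> [C [C0 gC gL]] [D [D0 hD hL]]; exists (C + D); split=> [|y|y z d d0 yz].
- exact: addr_ge0.
- by apply: (le_trans (ler_normD _ _)); rewrite lerD.
- rewrite opprD addrACA mulrDl; apply: (le_trans (ler_normD _ _)).
  by rewrite lerD// ?gL ?hL.
Qed.

Lemma temperedM g h : tempered g -> tempered h -> tempered (fun y => g y * h y).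
Proof.
move=> [C [C0 gC gL]] [D [D0 hD hL]]; exists (2 * C * D); split=> [|y|y z d d0 yz].
- by rewrite !mulr_ge0.
- have : `|g y * h y| <= C * D by rewrite normrM ler_pM.
  by have := mulr_ge0 C0 D0; nra.
- have -> : g y * h y - g z * h z = g y * (h y - h z) + (g y - g z) * h z by ring.
  apply: (le_trans (ler_normD _ _)).
  have -> : 2 * C * D * d = C * (D * d) + (C * d) * D by ring.
  by rewrite !normrM; apply: lerD; apply: ler_pM => //; [exact: hL|exact: gL].
Qed.

(** Boundedness is automatic: a Lipschitz function of a bounded function is
bounded. *)
Lemma tempered_comp (A : set R) (phi : R -> R) (L : R) g :
  (forall s t, A s -> A t -> `|phi s - phi t| <= L * `|s - t|) ->
  (forall y, A (g y)) -> tempered g -> tempered (fun y => phi (g y)).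
Proof.
move=> phiL Ag [C [C0 gC gL]].
pose K := `|L| * C.
have K0 : 0 <= K by rewrite mulr_ge0.
have phiK y z : `|phi (g y) - phi (g z)| <= `|L| * `|g y - g z|.
  apply: (le_trans (phiL _ _ (Ag _) (Ag _))).
  by rewrite ler_wpM2r// ler_norm.
exists (2 * K + `|phi (g (fun=> 0))|); split=> [|y|y z d d0 yz].
- by rewrite addr_ge0// mulr_ge0.
- have -> : phi (g y) = (phi (g y) - phi (g (fun=> 0))) + phi (g (fun=> 0)).
    by rewrite subrK.
  apply: (le_trans (ler_normD _ _)); rewrite lerD2r.
  apply: (le_trans (phiK _ _)); rewrite /K mulrCA ler_wpM2l//.
  apply: (le_trans (ler_normB _ _)).
  by have := gC y; have := gC (fun=> 0); lra.
- apply: (le_trans (phiK _ _)); apply: (@le_trans _ _ (K * d)).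
    by rewrite /K -mulrA ler_wpM2l// gL.
  by rewrite ler_wpM2r//; have := normr_ge0 (phi (g (fun=> 0))); lra.
Qed.

Lemma temperedV (e : R) g : 0 < e -> (forall y, e <= `|g y|) ->
  tempered g -> tempered (fun y => (g y)^-1).
Proof.
move=> e0 eg; apply: (@tempered_comp [set x | e <= `|x|] GRing.inv (e ^- 2)) => //.
move=> s t /= es et.
have s0 : s != 0 by rewrite -normr_gt0 (lt_le_trans e0).
have t0 : t != 0 by rewrite -normr_gt0 (lt_le_trans e0).
have -> : s^-1 - t^-1 = (t - s) * (s^-1 * t^-1) by field; rewrite s0 t0.
have Ve (x : R) : e <= `|x| -> `|x^-1| <= e^-1.
  by move=> ex; rewrite normfV lef_pV2// posrE// (lt_le_trans e0).
rewrite normrM distrC mulrC ler_wpM2r// normrM expr2 invfM.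
by apply: ler_pM => //; apply: Ve.
Qed.

End bounded_lipschitz_calculus.

(** * The state behind the precursor shock *)

Section precursor_shock.
Variables (R : realType) (gu rho0 p0 sp : R).
Hypotheses (hgu : 1 < gu) (hrho0 : 0 < rho0) (hp0 : 0 < p0).
Hypothesis hsp : sound_speed0 gu rho0 p0 < sp.

Let gu0 : 0 < gu. Proof. exact: lt_trans hgu. Qed.

Lemma precursor_speed_gt0 : 0 < sp.
Proof. exact: le_lt_trans (sqrtr_ge0 _) hsp. Qed.

Let alpha := rho0 / rho1 gu rho0 p0 sp.

Lemma precursor_supersonic : gu * (p0 / rho0) < sp ^+ 2.
Proof.
have c0 : 0 <= gu * p0 / rho0 by rewrite divr_ge0 ?mulr_ge0// ltW.
rewrite mulrA -(sqr_sqrtr c0) ltr_pXn2r// nnegrE ?sqrtr_ge0//.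
exact/ltW/precursor_speed_gt0.
Qed.

(** The definition of [rho1] cleared of denominators; [gu * (p0 / rho0)] is the
squared speed of sound ahead of the shock. *)
Lemma density_ratioE :
  alpha * (gu + 1) * sp ^+ 2 = (gu - 1) * sp ^+ 2 + 2 * (gu * (p0 / rho0)).
Proof.
have c0 : 0 <= gu * p0 / rho0 by rewrite divr_ge0 ?mulr_ge0// ltW.
have s0 := precursor_speed_gt0.
rewrite /alpha /rho1 /mach_p expr_div_n /sound_speed0 sqr_sqrtr//.
have pgr : 0 < gu * p0 / rho0 by rewrite divr_gt0// mulr_gt0.
have ? : 0 < (gu - 1) * sp ^+ 2 * rho0 + 2 * (gu * p0).
  by rewrite ltr_wpDl ?mulr_gt0// !mulr_ge0 ?subr_ge0// ltW.
field.
by rewrite !gt_eqF//= ?mulrA//; have := hgu; lra.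
Qed.

Lemma density_ratio_itv : 0 < alpha < 1.
Proof.
have gu1 := hgu; have := density_ratioE.
have := precursor_supersonic; have := precursor_speed_gt0.
have : 0 < gu * (p0 / rho0) by rewrite mulr_gt0// divr_gt0.
move: (gu * (p0 / rho0)) => a a0 s0 as_ E.
have s2 : 0 < sp ^+ 2 by rewrite exprn_gt0.
have g1 : 0 < (gu + 1) * sp ^+ 2 by rewrite mulr_gt0// addr_gt0.
apply/andP; split.
- have : 0 < alpha * ((gu + 1) * sp ^+ 2).
    rewrite mulrA E; have : 0 < (gu - 1) * sp ^+ 2 by rewrite mulr_gt0 ?subr_gt0.
    by lra.
  by rewrite pmulr_lgt0.
- have : alpha * ((gu + 1) * sp ^+ 2) < 1 * ((gu + 1) * sp ^+ 2).
    by rewrite mulrA E; lra.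
  by rewrite ltr_pM2r.
Qed.

Lemma rho1_gt0 : 0 < rho1 gu rho0 p0 sp.
Proof.
by have /andP[+ _] := density_ratio_itv; rewrite /alpha pmulr_rgt0// invr_gt0.
Qed.

Lemma u1_itv : 0 < u1 gu rho0 p0 sp < sp.
Proof.
have /andP[a0 a1] := density_ratio_itv; rewrite /u1 -/alpha.
by have := precursor_speed_gt0 => s0; apply/andP; split; nra.
Qed.

Lemma p1_gt0 : 0 < p1 gu rho0 p0 sp.
Proof.
have /andP[a0 a1] := density_ratio_itv; rewrite /p1 -/alpha.
by rewrite addr_gt0// !mulr_gt0// ?exprn_gt0 ?precursor_speed_gt0// subr_gt0.
Qed.

Lemma s1_gt0 : 0 < s1 gu rho0 p0 sp.
Proof. by rewrite /s1 divr_gt0 ?p1_gt0// powR_gt0// rho1_gt0. Qed.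

Lemma s1_powR : s1 gu rho0 p0 sp * rho1 gu rho0 p0 sp `^ gu = p1 gu rho0 p0 sp.
Proof. by rewrite /s1 divfK// gt_eqF// powR_gt0// rho1_gt0. Qed.

Lemma p1_div_rho1 : p1 gu rho0 p0 sp / rho1 gu rho0 p0 sp
  = alpha * (p0 / rho0 + (1 - alpha) * sp ^+ 2).
Proof.
have r1 := rho1_gt0.
by rewrite /p1 -/alpha /alpha; field; rewrite !gt_eqF.
Qed.

Lemma s1_powRB1 : s1 gu rho0 p0 sp * rho1 gu rho0 p0 sp `^ (gu - 1)
  = p1 gu rho0 p0 sp / rho1 gu rho0 p0 sp.
Proof.
have r1 := rho1_gt0.
rewrite -s1_powR -[in RHS](mulr_powRB1 (ltW r1) gu0).
by field; rewrite gt_eqF.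
Qed.

(** The flow behind the shock is subsonic relative to the shock, because the
shock itself is faster than sound ahead of it. *)
Lemma subsonic_behind_shock : (u1 gu rho0 p0 sp - sp) ^+ 2
  < gu * s1 gu rho0 p0 sp * rho1 gu rho0 p0 sp `^ (gu - 1).
Proof.
rewrite -mulrA s1_powRB1 p1_div_rho1 /u1 -/alpha.
have gu1 := hgu; have := density_ratioE.
have := precursor_supersonic; have := precursor_speed_gt0.
have /andP[a0 a1] := density_ratio_itv.
move: (p0 / rho0) => q s0; set s := sp ^+ 2 => qs E.
have -> : ((1 - alpha) * sp - sp) ^+ 2 = alpha * (alpha * s) by rewrite /s; ring.
have -> : gu * (alpha * (q + (1 - alpha) * s))
  = alpha * (gu * q + gu * (1 - alpha) * s) by ring.
by rewrite ltr_pM2l//; lra.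
Qed.

End precursor_shock.

(** * Signs along a solution *)

Section solutions.
Variables (R : realType) (gu rho0 p0 sp : R).
Hypotheses (hgu : 1 < gu) (hrho0 : 0 < rho0) (hp0 : 0 < p0).
Hypothesis hsp : sound_speed0 gu rho0 p0 < sp.
Implicit Types (r u : R -> R) (s t x y : R).

Local Notation k := (gu * s1 gu rho0 p0 sp).
Local Notation sonic := (sonic gu rho0 p0 sp).
Local Notation is_solution := (is_solution gu rho0 p0 sp).

Lemma sound_coefficient_gt0 : 0 < k.
Proof. by rewrite mulr_gt0 ?s1_gt0// (lt_trans _ hgu). Qed.

Lemma sound_speed_sqr r x :
  sound_speed gu rho0 p0 sp r x ^+ 2 = k * r x `^ (gu - 1).
Proof. by rewrite sqr_sqrtr// mulr_ge0 ?powR_ge0// ltW ?sound_coefficient_gt0. Qed.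

Lemma sonicE r u x : sonic r u x = (u x - x) ^+ 2 - k * r x `^ (gu - 1).
Proof. by rewrite /Defs.sonic sound_speed_sqr. Qed.

Lemma solution_derive s r u t : is_solution s r u -> s < t < sp -> 0 < t ->
  is_derive t 1 r (- (2 * u t * (u t - t) / (t * sonic r u t)) * r t) /\
  is_derive t 1 u (2 * (k * r t `^ (gu - 1)) / (t * sonic r u t) * u t).
Proof.
move=> [_ _ _ [r' [u' [[dr _] [du _] rE uE]]] _] /andP[st tsp] t0.
have At : [set x | s <= x <= sp /\ 0 < x] t by split => //; rewrite !ltW.
have nA : nbhs t [set x | s <= x <= sp /\ 0 < x].
  near=> x; split; last by near: x; exact: lt_nbhsr.
  by apply/andP; split; apply: ltW; near: x; [exact: lt_nbhsr|exact: lt_nbhsl].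
rewrite -sound_speed_sqr -uE// -rE//; split.
- by apply: derivative_within_is_derive nA _; exact: dr.
- by apply: derivative_within_is_derive nA _; exact: du.
Unshelve. all: by end_near. Qed.

Lemma solution_continuous s r u y : is_solution s r u -> s <= y ->
  [/\ {within `[y, sp], continuous r}, {within `[y, sp], continuous u} &
      {within `[y, sp], continuous (sonic r u)}].
Proof.
move=> [[cr cu] r0 _ _ _] sy.
have sub : `[y, sp] `<=` `[s, sp] by apply: subset_itv; rewrite bnd_simp.
have cr' := continuous_subspaceW sub cr.
have cu' := continuous_subspaceW sub cu.
split=> //.
have -> : sonic r u =
    (u - id) * (u - id) - (fun=> k) * (fun x => r x `^ (gu - 1)).
  by apply/funext => x; rewrite sonicE expr2.
have cud := within_continuousB cu' (@within_continuous_id R `[y, sp]).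
apply: within_continuousB; first exact: within_continuousM.
apply: within_continuousM; first exact: within_continuous_cst.
apply: within_continuous_powR => //; first by rewrite subr_gt0.
by move=> x /sub; rewrite /= in_itv/= => /r0.
Qed.

(** A continuous function without zeros keeps the sign it has at [sp]. *)
Lemma solution_sonic_lt0 s r u t : is_solution s r u -> s <= t <= sp -> 0 < t ->
  sonic r u t < 0.
Proof.
move=> sol /andP[st tsp] t0.
have [_ _ c] := solution_continuous sol st.
have [_ _ sonic0 _ [rsp usp]] := sol.
rewrite -oppr_gt0 -[X in 0 < X]/((- sonic r u) t).
apply: (@nonvanishing_gt0 R (- sonic r u) t sp); last by rewrite lexx.
- by move=> x; apply: cvgN; exact: c.
- move=> x /andP[tx xsp]; rewrite fctE oppr_eq0; apply: sonic0; split.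
    by rewrite (le_trans st tx).
  exact: lt_le_trans tx.
- rewrite fctE oppr_gt0 sonicE rsp usp subr_lt0.
  exact: subsonic_behind_shock.
Qed.

(** Both equations are linear in their unknown, with coefficients bounded on
[t, sp] because the denominators are continuous and nonzero. *)
Lemma solution_gt0 s r u t : is_solution s r u -> s <= t <= sp -> 0 < t ->
  0 < r t /\ 0 < u t.
Proof.
move=> sol /andP[st tsp] t0.
have [cr cu cs] := solution_continuous sol st.
have [_ r_ge0 _ _ [rsp usp]] := sol.
have ct := @within_continuous_id R `[t, sp].
have tsp0 x : t <= x <= sp -> s <= x <= sp /\ 0 < x.
  move=> /andP[tx ->]; rewrite (le_trans st tx); split=> //.
  exact: lt_le_trans tx.
have tsp1 x : t < x < sp -> s < x < sp /\ 0 < x.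
  move=> /andP[tx ->]; rewrite (le_lt_trans st tx); split=> //.
  exact: lt_trans tx.
have cden : {within `[t, sp], continuous (fun x => (x * sonic r u x)^-1)}.
  apply: within_continuousV; last exact: within_continuousM.
  move=> x; rewrite /= in_itv/= => /tsp0[xs x0].
  by rewrite mulf_eq0 gt_eqF//= lt_eqF// (solution_sonic_lt0 sol).
have c2 := @within_continuous_cst R `[t, sp] 2.
split.
- pose A x := - (2 * u x * (u x - x) / (x * sonic r u x)).
  have [K AK] : exists K, forall x, t <= x <= sp -> `|A x| <= K.
    apply: within_continuous_bounded => x; apply: cvgN; move: x.
    apply: within_continuousM cden; apply: within_continuousM.
      exact: within_continuousM.
    exact: within_continuousB.
  apply: (@gronwall_gt0 R r (fun x => A x * r x) t sp K) => //.
  + by move=> x /tsp1[xs x0]; have [] := solution_derive sol xs x0.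
  + move=> x /[dup] /tsp1[/andP[sx xsp] x0] /andP[tx _]; rewrite ler_wpM2r//.
      by apply: r_ge0; rewrite !ltW.
    by apply: (le_trans (ler_norm _)); apply: AK; rewrite !ltW.
  + by rewrite rsp rho1_gt0.
  + by rewrite lexx.
(* The sign of [u] is not known yet: its square is shown to be positive. *)
- pose B x := 2 * (k * r x `^ (gu - 1)) / (x * sonic r u x).
  have [K BK] : exists K, forall x, t <= x <= sp -> `|B x| <= K.
    apply: within_continuous_bounded.
    apply: within_continuousM cden; apply: within_continuousM => //.
    apply: within_continuousM; first exact: within_continuous_cst.
    apply: within_continuous_powR => //; first by rewrite subr_gt0.
    by move=> x; rewrite /= in_itv/= => /tsp0[/r_ge0].
  have u2 x : t <= x <= sp -> 0 < (u * u) x.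
    apply: (@gronwall_gt0 R (u * u)
      (fun x => u x *: (B x * u x) + u x *: (B x * u x)) t sp (2 * K)).
    + exact: within_continuousM.
    + move=> z /tsp1[zs z0]; have [_ du] := solution_derive sol zs z0.
      exact: is_deriveM.
    + move=> z /andP[tz zsp]; rewrite /GRing.scale/= fctE.
      have : B z <= K by apply: (le_trans (ler_norm _)); apply: BK; rewrite !ltW.
      by have := sqr_ge0 (u z); nra.
    + rewrite fctE usp; have /andP[u0 _] := u1_itv hgu hrho0 hp0 hsp.
      exact: mulr_gt0.
  apply: (@nonvanishing_gt0 R u t sp) => //; last by rewrite lexx.
  + by move=> x /u2; rewrite fctE lt0r mulf_eq0 orbb => /andP[].
  + by rewrite usp; have /andP[] := u1_itv hgu hrho0 hp0 hsp.
Qed.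

Lemma solution_velocity_nonincreasing s r u x y : is_solution s r u ->
  s <= x -> 0 < x -> x <= y -> y <= sp -> u y <= u x.
Proof.
move=> sol sx x0 xy ysp.
have [_ cu _] := solution_continuous sol sx.
have xt t : x < t < sp -> s < t < sp /\ 0 < t.
  move=> /andP[xt tsp]; rewrite (le_lt_trans sx xt) tsp; split=> //.
  exact: lt_trans xt.
pose u' t := 2 * (k * r t `^ (gu - 1)) / (t * sonic r u t) * u t.
apply: (nonincreasing_is_derive (f' := u') cu) xy ysp => //.
- by move=> t /xt[st t0]; have [_] := solution_derive sol st t0; exact.
- move=> t /xt[/andP[st tsp] t0].
  have stsp : s <= t <= sp by rewrite !ltW.
  have [r0 u0] := solution_gt0 sol stsp t0.
  have S0 := solution_sonic_lt0 sol stsp t0.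
  rewrite /u' mulr_le0_ge0 ?(ltW u0)// mulr_ge0_le0//.
    by rewrite mulr_ge0// mulr_ge0 ?powR_ge0// ltW// sound_coefficient_gt0.
  by rewrite invr_le0 mulr_ge0_le0// ltW.
Qed.

End solutions.

(** * Reduction to a bounded Lipschitz field *)

(** The position is one of the unknowns, with derivative 1, so that the system
becomes autonomous. *)
Inductive coordinate := Position | Density | Velocity.

Definition trajectory (R : realType) (r u : R -> R) (i : coordinate) : R -> R :=
  match i with Position => id | Density => r | Velocity => u end.

(** The region in which clamping changes nothing.  One small parameter serves
for all the bounds, so that two solutions can be placed in a common region. *)
Definition tame (R : realType) (gu k eps x r u : R) : Prop :=
  [/\ eps <= x <= eps^-1, eps <= r <= eps^-1, 0 <= u <= eps^-1 &
      (u - x) ^+ 2 - k * r `^ (gu - 1) <= - eps].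

Section clamped_field.
Variables (R : realType) (gu k eps : R).
Implicit Type y : coordinate -> R.

Let xh y := clamp eps eps^-1 (y Position).
Let rh y := clamp eps eps^-1 (y Density).
Let uh y := clamp 0 eps^-1 (y Velocity).
Let sonich y := Num.min ((uh y - xh y) ^+ 2 - k * rh y `^ (gu - 1)) (- eps).

(** The right-hand side of the intermediate-zone system, with its arguments
clamped and the sonic function kept below [- eps]. *)
Definition clamped_field (i : coordinate) y : R :=
  match i with
  | Position => 1
  | Density => - (2 * uh y * (uh y - xh y) / (xh y * sonich y)) * rh y
  | Velocity => 2 * (k * rh y `^ (gu - 1)) / (xh y * sonich y) * uh y
  end.

Lemma clamped_field_bounded_lipschitz : 0 < eps <= 1 ->
  exists C, forall i, bounded_lipschitz C (clamped_field i).
Proof.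
move=> /andP[eps0 eps1].
have epsV : eps <= eps^-1 by rewrite (le_trans eps1)// invf_ge1.
have tx : tempered xh by exact: tempered_clamp.
have tr : tempered rh by exact: tempered_clamp.
have tu : tempered uh by apply: tempered_clamp; rewrite invr_ge0 ltW.
have tN g : tempered g -> tempered (fun y : coordinate -> R => - g y).
  move=> tg; have := temperedM (@tempered_cst R coordinate (-1)) tg.
  by under [X in tempered X]eq_fun do rewrite mulN1r.
have tp : tempered (fun y => k * rh y `^ (gu - 1)).
  apply: temperedM; first exact: tempered_cst.
  have [L LP] := powR_lipschitz (gu - 1) eps0 epsV.
  by apply: (tempered_comp LP) tr => y; exact: clamp_itv.
have tux : tempered (fun y => uh y - xh y) by apply: temperedD => //; exact: tN.
have tS : tempered sonich.
  apply: (@tempered_comp _ _ setT (fun s => Num.min s (- eps)) 1) => //.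
    move=> s t _ _; rewrite mul1r !minElt.
    by case: ifPn => ?; case: ifPn => ?; rewrite ?subrr ?normr0//;
      case: (ger0P (s - t)) => ?; rewrite ler_norml; apply/andP; split; lra.
  by apply: temperedD; [exact: temperedM|exact: tN].
have tden : tempered (fun y => (xh y * sonich y)^-1).
  apply: (@temperedV _ _ (eps * eps)); first exact: mulr_gt0.
    move=> y; rewrite normrM; apply: ler_pM; [exact: ltW|exact: ltW| |].
      have /andP[ex _] := clamp_itv (y Position) epsV.
      by rewrite (le_trans ex)// ler_norm.
    have : sonich y <= - eps by rewrite ge_min lexx orbT.
    by rewrite lerNr => /le_trans; apply; rewrite -normrN ler_norm.
  exact: temperedM.
have t2 : tempered (fun _ : coordinate -> R => 2) by exact: tempered_cst.
have [C1 PC1] : tempered (clamped_field Position) by exact: tempered_cst.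
have [C2 PC2] : tempered (clamped_field Density).
  apply: temperedM tr; apply: tN; apply: temperedM tden.
  by apply: temperedM tux; exact: temperedM.
have [C3 PC3] : tempered (clamped_field Velocity).
  by apply: temperedM tu; apply: temperedM tden; exact: temperedM.
have C10 : 0 <= C1 by case: PC1.
have C20 : 0 <= C2 by case: PC2.
have C30 : 0 <= C3 by case: PC3.
exists (C1 + C2 + C3); case.
- by apply: bounded_lipschitz_le PC1; lra.
- by apply: bounded_lipschitz_le PC2; lra.
- by apply: bounded_lipschitz_le PC3; lra.
Qed.

Lemma clamped_fieldE x (r u : R -> R) (S := (u x - x) ^+ 2 - k * r x `^ (gu - 1)) :
  tame gu k eps x (r x) (u x) ->
  clamped_field Density ((trajectory r u)^~ x)
    = - (2 * u x * (u x - x) / (x * S)) * r x /\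
  clamped_field Velocity ((trajectory r u)^~ x)
    = 2 * (k * r x `^ (gu - 1)) / (x * S) * u x.
Proof.
move=> [ex er eu Se].
by rewrite /clamped_field /sonich /xh /rh /uh /= !clamp_id// min_l.
Qed.

End clamped_field.

Section solutions_of_clamped_field.
Variables (R : realType) (gu rho0 p0 sp : R).
Hypotheses (hgu : 1 < gu) (hrho0 : 0 < rho0) (hp0 : 0 < p0).
Hypothesis hsp : sound_speed0 gu rho0 p0 < sp.
Implicit Types (r u : R -> R) (s t x y eps : R).

Local Notation k := (gu * s1 gu rho0 p0 sp).
Local Notation sonic := (sonic gu rho0 p0 sp).
Local Notation is_solution := (is_solution gu rho0 p0 sp).

(** Compactness of [y, sp], on which density and position are positive and
the sonic function is negative. *)
Lemma solution_tame s r u y : is_solution s r u -> s <= y -> 0 < y ->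
  exists e0, 0 < e0 <= 1 /\ forall eps t, 0 < eps <= e0 -> y <= t <= sp ->
    tame gu k eps t (r t) (u t).
Proof.
move=> sol sy y0.
have [cr cu cs] := solution_continuous hgu hrho0 hp0 hsp sol sy.
have tsp0 x : y <= x <= sp -> s <= x <= sp /\ 0 < x.
  move=> /andP[tx ->]; rewrite (le_trans sy tx); split=> //.
  exact: lt_le_trans tx.
have [e1 [e10 re1]] : exists e, 0 < e /\ forall t, y <= t <= sp -> e <= r t.
  apply: positive_bounded_below cr _ => t /tsp0[ts t0].
  by have [] := solution_gt0 hgu hrho0 hp0 hsp sol ts t0.
have [e2 [e20 se2]] : exists e, 0 < e /\
    forall t, y <= t <= sp -> e <= (- sonic r u) t.
  apply: positive_bounded_below; first by move=> x; apply: cvgN; exact: cs.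
  move=> t /tsp0[ts t0]; rewrite fctE oppr_gt0.
  exact: (solution_sonic_lt0 hgu hrho0 hp0 hsp sol).
have [K1 rK1] := within_continuous_bounded cr.
have [K2 uK2] := within_continuous_bounded cu.
pose K := 1 + `|K1| + `|K2| + `|sp|.
have K0 : 0 < K by rewrite /K -!addrA ltr_wpDr// !addr_ge0.
exists (Num.min (Num.min e1 e2) (Num.min y K^-1)); split.
  rewrite !lt_min e10 e20 y0 invr_gt0 K0/= !ge_min invf_le1//.
  by rewrite /K -!addrA lerDl !addr_ge0// !orbT.
move=> eps t; rewrite !le_min => /andP[eps0 /andP[/andP[ee1 ee2] /andP[ey eK]]] tI.
have KV : K <= eps^-1 by rewrite -[K]invrK lef_pV2// posrE// invr_gt0.
have [ts t0] := tsp0 _ tI; have /andP[yt tsp] := tI.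
have [r0 u0] := solution_gt0 hgu hrho0 hp0 hsp sol ts t0.
have n1 := ler_norm K1; have n2 := ler_norm K2; have n3 := ler_norm sp.
have m1 := normr_ge0 K1; have m2 := normr_ge0 K2; have m3 := normr_ge0 sp.
split.
- by rewrite (le_trans ey yt)/= (le_trans _ KV)// /K; lra.
- rewrite (le_trans ee1 (re1 _ tI))/= (le_trans _ KV)//.
  by have := le_trans (ler_norm _) (rK1 _ tI); rewrite /K; lra.
- rewrite (ltW u0)/= (le_trans _ KV)//.
  by have := le_trans (ler_norm _) (uK2 _ tI); rewrite /K; lra.
- rewrite -(sonicE hgu hrho0 hp0 hsp).
  by have := se2 _ tI; rewrite fctE; lra.
Qed.

Lemma solution_solves s r u y eps : is_solution s r u -> s <= y -> 0 < y ->
  (forall t, y <= t <= sp -> tame gu k eps t (r t) (u t)) ->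
  solves (clamped_field gu k eps) y sp (trajectory r u).
Proof.
move=> sol sy y0 ty.
have [cr cu _] := solution_continuous hgu hrho0 hp0 hsp sol sy.
have tsp1 x : y < x < sp -> s < x < sp /\ 0 < x.
  move=> /andP[tx ->]; rewrite (le_lt_trans sy tx); split=> //.
  exact: lt_trans tx.
have der t : y < t < sp ->
    is_derive t 1 r (clamped_field gu k eps Density ((trajectory r u)^~ t)) /\
    is_derive t 1 u (clamped_field gu k eps Velocity ((trajectory r u)^~ t)).
  move=> /[dup] /andP[yt tsp] /tsp1[ts t0].
  have [|-> ->] := @clamped_fieldE R gu k eps t r u; first by apply: ty; rewrite !ltW.
  rewrite -(sonicE hgu hrho0 hp0 hsp).
  exact: (solution_derive hgu hrho0 hp0 hsp sol).
case; split => //=.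
- exact: within_continuous_id.
- by move=> t _; exact: is_derive_id.
- by move=> t /der[].
- by move=> t /der[].
Qed.

Lemma solution_unique s s' r u r' u' y : is_solution s r u ->
  is_solution s' r' u' -> s <= y -> s' <= y -> 0 < y ->
  forall t, y <= t <= sp -> r t = r' t /\ u t = u' t.
Proof.
move=> sol sol' sy sy' y0.
have [e [e01 te]] := solution_tame sol sy y0.
have [e' [e'01 te']] := solution_tame sol' sy' y0.
have /andP[e0 e1] := e01; have /andP[e'0 e'1] := e'01.
pose eps := Num.min e e'.
have eps0 : 0 < eps by rewrite lt_min e0.
have epse : 0 < eps <= e by rewrite eps0 ge_min lexx.
have epse' : 0 < eps <= e' by rewrite eps0 ge_min lexx orbT.
have eps01 : 0 < eps <= 1 by rewrite eps0 ge_min e1.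
have [C CF] := clamped_field_bounded_lipschitz gu k eps01.
have S := solution_solves sol sy y0 (fun t => te eps t epse).
have S' := solution_solves sol' sy' y0 (fun t => te' eps t epse').
have eqsp i : trajectory r u i sp = trajectory r' u' i sp.
  by case: sol sol' => [_ _ _ _ [rsp usp]] [_ _ _ _ [rsp' usp']];
    case: i => //=; rewrite ?rsp ?usp.
move=> t tI; have h i := solves_unique CF S S' eqsp i tI.
by split; [exact: (h Density)|exact: (h Velocity)].
Qed.


Lemma solves_is_solution eps a s (Y : coordinate -> R -> R) :
  0 < eps <= 1 -> 0 < s -> s <= sp -> a <= s ->
  (forall i t, a <= t <= sp ->
     is_derive t 1 (Y i) (clamped_field gu k eps i (Y^~ t))) ->
  (forall t, a <= t <= sp -> Y Position t = t) ->
  Y Density sp = rho1 gu rho0 p0 sp -> Y Velocity sp = u1 gu rho0 p0 sp ->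
  (forall t, s <= t <= sp -> tame gu k eps t (Y Density t) (Y Velocity t)) ->
  is_solution s (Y Density) (Y Velocity).
Proof.
move=> eps01 s0 ssp as_ dY YP Yr Yu ty.
have /andP[eps0 _] := eps01.
have [C CF] := clamped_field_bounded_lipschitz gu k eps01.
have asp t : s <= t <= sp -> a <= t <= sp.
  by move=> /andP[st ->]; rewrite (le_trans as_ st).
have cY i : {within `[a, sp], continuous (Y i)}.
  apply: continuous_in_subspaceT => t; rewrite inE/= in_itv/= => tI.
  exact: is_derive_continuous (dY i t tI).
have sub : `[s, sp] `<=` `[a, sp] by apply: subset_itv; rewrite bnd_simp.
have YL i x y : a <= x <= sp -> a <= y <= sp -> `|Y i x - Y i y| <= C * `|x - y|.
  apply: (solves_lipschitz CF) => j; split=> // t /andP[? ?].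
  by apply: dY; rewrite !ltW.
have trE t : a <= t <= sp -> Y^~ t = (trajectory (Y Density) (Y Velocity))^~ t.
  by move=> tI; apply/funext; case => //=; rewrite YP.
have C1Y i : C1_with [set x : R | s <= x <= sp /\ 0 < x] (Y i)
    (fun t => clamped_field gu k eps i (Y^~ t)).
  split=> [t [/asp tI _]|]; first exact: is_derive_derivative_within (dY i t tI).
  apply: (@within_continuous_lipschitz _ _ _ (C * C)) => x y [/asp xI _] [/asp yI _].
  have [C0 _ FL] := CF i; rewrite -mulrA; apply: FL; first by rewrite mulr_ge0.
  by move=> j; exact: YL.
split.
- by split; apply: continuous_subspaceW sub _; exact: cY.
- by move=> t /ty[_ /andP[er _] _ _]; rewrite (le_trans _ er)// ltW.
- move=> t [/ty[_ _ _ Se] _]; rewrite (sonicE hgu hrho0 hp0 hsp) lt_eqF//.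
  by rewrite (le_lt_trans Se)// oppr_lt0.
- exists (fun t => clamped_field gu k eps Density (Y^~ t)),
         (fun t => clamped_field gu k eps Velocity (Y^~ t)); split => //.
  + move=> t [tI _]; rewrite trE ?asp//; have [-> _] := clamped_fieldE (ty t tI).
    by rewrite (sonicE hgu hrho0 hp0 hsp).
  + move=> t [tI _]; rewrite trE ?asp//; have [_ ->] := clamped_fieldE (ty t tI).
    by rewrite (sonicE hgu hrho0 hp0 hsp) (sound_speed_sqr hgu hrho0 hp0 hsp).
- by [].
Qed.

(** The clamped system has a solution on the longer interval [s / 2, sp].
It agrees with [(r, u)] on [s, sp] by uniqueness.  At [s] the inequalities
that define the unclamped region, and [u < x], are strict, hence they persist on
some [s', s], where the clamped solution solves the original system. *)
Lemma solution_extends s r u : is_solution s r u -> 0 < s -> s <= sp ->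
  u s < s ->
  exists s' r' u', [/\ 0 < s', s' < s, is_solution s' r' u',
    forall t, s' <= t <= s -> 0 <= u' t <= t &
    forall t, s <= t <= sp -> r' t = r t /\ u' t = u t].
Proof.
move=> sol s0 ssp us.
have [e0 [/andP[e00 e01] te0]] := solution_tame sol (lexx s) s0.
have sI : s <= s <= sp by rewrite lexx.
have [r0 u0] := solution_gt0 hgu hrho0 hp0 hsp sol sI s0.
(* Halving the parameter makes the bounds of [tame] that involve it strict at
   [s]. *)
pose eps := e0 / 2.
have eps0 : 0 < eps by rewrite divr_gt0.
have epse : eps < e0 by rewrite /eps; lra.
have eps01 : 0 < eps <= 1 by rewrite eps0 ltW// (lt_le_trans epse).
have epsV : e0^-1 < eps^-1 by rewrite ltf_pV2.
have [C CF] := clamped_field_bounded_lipschitz gu k eps01.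
pose a := s / 2.
have as_ : a < s by rewrite /a; lra.
have asp : a <= sp by rewrite (le_trans _ ssp)// ltW.
have [Y [Ysp dY]] := solves_exists (fun i => trajectory r u i sp) CF asp.
have cYt i t : a <= t <= sp -> {for t, continuous (Y i)}.
  by move=> tI; exact: is_derive_continuous (dY i t tI).
have cY i : {within `[a, sp], continuous (Y i)}.
  by apply: continuous_in_subspaceT => t; rewrite inE/= in_itv/=; exact: cYt.
have YP t : a <= t <= sp -> Y Position t = t.
  move=> tI; have spI : a <= sp <= sp by rewrite asp lexx.
  have : `|(Y Position - id) sp - (Y Position - id) t| <= 0 * `|sp - t|.
    apply: (@lipschitz_is_derive R a sp 0 (Y Position - id) (fun=> 1 - 1)) => //.
    - exact: within_continuousB (@within_continuous_id R _).
    - move=> x /andP[ax xsp]; apply: is_deriveB.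
      by apply: (dY Position); rewrite !ltW.
    - by move=> x _; rewrite subrr normr0.
  by rewrite mul0r !fctE Ysp /= subrr sub0r normrN normr_le0 subr_eq0 => /eqP.
have solY : solves (clamped_field gu k eps) s sp Y.
  move=> i; split.
    by apply: continuous_subspaceW (cY i); apply: subset_itv; rewrite bnd_simp// ltW.
  by move=> t /andP[st tsp]; apply: dY; rewrite (ltW tsp) (ltW (lt_trans as_ st)).
have teps t : s <= t <= sp -> tame gu k eps t (r t) (u t).
  by apply: te0; rewrite eps0 ltW.
have Yru t : s <= t <= sp -> Y Density t = r t /\ Y Velocity t = u t.
  have := solves_unique CF solY (solution_solves sol (lexx s) s0 teps) Ysp.
  by move=> h tI; split; [exact: (h Density)|exact: (h Velocity)].
have sa : a <= s <= sp by rewrite ltW.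
have cr := cYt Density s sa; have cu := cYt Velocity s sa.
have [rs usE] := Yru s sI.
pose S t := (Y Velocity t - t) ^+ 2 - k * Y Density t `^ (gu - 1).
have cS : {for s, continuous S}.
  have c1 : Y Velocity t - t @[t --> s] --> Y Velocity s - s.
    exact: (cvgB cu (@cvg_id _ _)).
  have c2 : k * Y Density t `^ (gu - 1) @[t --> s] --> k * Y Density s `^ (gu - 1).
    apply: cvgMl_tmp.
    apply: (@continuous_cvg _ _ _ _ _ (Y Density) (@powR R ^~ (gu - 1))
      (Y Density s)) => //.
    by rewrite rs; exact: is_derive_continuous (is_derive1_powR (gu - 1) r0).
  exact: (cvgB (cvgM c1 c1) c2).
have [tx tr tu tS] : tame gu k e0 s (r s) (u s) by apply: te0 => //; rewrite e00 lexx.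
have nearP : \forall t \near s, [/\ eps < t < eps^-1, eps < Y Density t < eps^-1,
    0 < Y Velocity t < eps^-1, S t < - eps & Y Velocity t < t].
  have /andP[x1 x2] := tx; have /andP[r1 r2] := tr; have /andP[_ u2] := tu.
  near=> t; split; try (apply/andP; split).
  - by near: t; apply: lt_nbhsr; lra.
  - by near: t; apply: lt_nbhsl; lra.
  - by near: t; apply: (cvgr_gt _ cr); rewrite rs; lra.
  - by near: t; apply: (cvgr_lt _ cr); rewrite rs; lra.
  - by near: t; apply: (cvgr_gt _ cu); rewrite usE.
  - by near: t; apply: (cvgr_lt _ cu); rewrite usE; lra.
  - by near: t; apply: (cvgr_lt _ cS); rewrite /S rs usE; lra.
  - rewrite -subr_lt0; near: t.
    apply: (cvgr_lt (Y Velocity s - s)); last by rewrite usE subr_lt0.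
    exact: (cvgB cu (@cvg_id _ _)).
have [d /= d0 dP] := nearP.
pose s' := s - Num.min d (s / 2) / 2.
have m0 : 0 < Num.min d (s / 2) by rewrite lt_min d0 divr_gt0.
have md : Num.min d (s / 2) <= d by rewrite ge_min lexx.
have ms : Num.min d (s / 2) <= s / 2 by rewrite ge_min lexx orbT.
have s's : s' < s by rewrite /s'; lra.
have s'0 : 0 < s' by rewrite /s'; lra.
have as' : a <= s' by rewrite /a /s'; lra.
have near' t : s' <= t <= s -> [/\ eps < t < eps^-1, eps < Y Density t < eps^-1,
    0 < Y Velocity t < eps^-1, S t < - eps & Y Velocity t < t].
  move=> /andP[s't ts]; apply: dP; rewrite /ball_/= ger0_norm ?subr_ge0//.
  by move: s't; rewrite /s'; lra.
exists s', (Y Density), (Y Velocity); split => //.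
- apply: (solves_is_solution eps01 s'0 _ as' dY YP); rewrite ?Ysp//=.
  + by rewrite (le_trans _ ssp)// ltW.
  + by case: sol => _ _ _ _ [].
  + by case: sol => _ _ _ _ [].
  + move=> t /andP[s't tsp]; have [st|/ltW ts] := leP s t.
      by have [|-> ->] := Yru t; [rewrite st|apply: teps; rewrite st].
    have [|/andP[? ?] /andP[? ?] /andP[? ?] ? _] := near' t; first by rewrite s't.
    by split; rewrite ?ltW.
- by move=> t /near'[_ _ /andP[? _] _ ?]; rewrite !ltW.
Unshelve. all: by end_near. Qed.

End solutions_of_clamped_field.

(** * The limit speed *)

Section limit_speed.
Variables (R : realType) (gu rho0 p0 sp sl : R) (r u : R -> R).
Hypotheses (hgu : 1 < gu) (hrho0 : 0 < rho0) (hp0 : 0 < p0).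
Hypothesis hsp : sound_speed0 gu rho0 p0 < sp.
Hypothesis hsl : infimums (admissible_speeds gu rho0 p0 sp) sl.
Hypothesis sol : is_solution gu rho0 p0 sp sl r u.

Let sl_lb s : admissible_speeds gu rho0 p0 sp s -> sl <= s.
Proof. by case: hsl => lb _; exact: lb. Qed.

Let admissible_below x : sl < x ->
  exists s, admissible_speeds gu rho0 p0 sp s /\ s < x.
Proof.
move=> slx; apply: contrapT => no.
have [_ glb] := hsl.
have : x <= sl.
  by apply: glb => s adm; rewrite leNgt; apply/negP => sx; apply: no; exists s.
by rewrite leNgt slx.
Qed.

(** The lower bound is [u1]: the velocity only grows below [sp], so that
[u <= x] fails as soon as [x < u1]. *)
Lemma limit_speed_itv : 0 < sl < sp.
Proof.
have /andP[u10 u1sp] := u1_itv hgu hrho0 hp0 hsp.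
apply/andP; split; last first.
  have [|s [adm _]] := @admissible_below (sl + 1); first by rewrite ltrDl.
  by have := sl_lb adm; case: adm => /andP[_ ssp] _ /le_lt_trans; apply.
apply: (lt_le_trans u10); have [_ glb] := hsl; apply: glb.
move=> s [/andP[s0 ssp] [r' [u' [sol' u'x]]]].
rewrite leNgt; apply/negP => su1.
pose x := (s + u1 gu rho0 p0 sp) / 2.
have sx : s < x by rewrite /x; lra.
have xu1 : x < u1 gu rho0 p0 sp by rewrite /x; lra.
have x0 : 0 < x by exact: le_lt_trans sx.
have xsp : x <= sp by rewrite ltW// (lt_trans xu1).
have := solution_velocity_nonincreasing hgu hrho0 hp0 hsp sol' (ltW sx) x0 xsp (lexx _).
have [_ _ _ _ [_ ->]] := sol'.
have [|/andP[_ ux] _] := u'x x; first by rewrite (ltW sx).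
by move=> /le_trans/(_ ux); rewrite leNgt xu1.
Qed.

Let sl0 : 0 < sl. Proof. by have /andP[] := limit_speed_itv. Qed.
Let slsp : sl < sp. Proof. by have /andP[] := limit_speed_itv. Qed.

(** Above [sl] the solution coincides with an admissible one, so [u x <= x].
Equality at [x] would give [x = u x <= u z <= z < x] at any [z] between [sl] and
[x]. *)
Lemma velocity_lt x : sl < x <= sp -> u x < x.
Proof.
have ule y : sl < y <= sp -> u y <= y.
  move=> /andP[sly ysp].
  have [s [[/andP[s0 ssp] [r' [u' [sol' u'x]]]] sy]] := admissible_below sly.
  have yI : y <= y <= sp by rewrite lexx.
  have y0 : 0 < y by exact: lt_trans sly.
  have [_ ->] := solution_unique hgu hrho0 hp0 hsp sol sol' (ltW sly) (ltW sy) y0 yI.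
  by have [|/andP[]] := u'x y; first by rewrite (ltW sy).
move=> /andP[slx xsp]; rewrite lt_neqAle ule ?slx// andbT; apply/eqP => uxx.
have slsl := sl0; pose z := (sl + x) / 2.
have slz : sl < z by rewrite /z; lra.
have zx : z < x by rewrite /z; lra.
have z0 : 0 < z by exact: lt_trans slz.
have := solution_velocity_nonincreasing hgu hrho0 hp0 hsp sol (ltW slz) z0 (ltW zx) xsp.
have := ule z; rewrite slz (ltW (lt_le_trans zx xsp)) => /(_ isT).
by rewrite uxx => /[swap] /le_trans/[apply]; rewrite leNgt zx.
Qed.

Lemma solution_density_gt0 x : sl <= x <= sp -> 0 < r x.
Proof.
move=> xI; have /andP[slx _] := xI.
by have [] := solution_gt0 hgu hrho0 hp0 hsp sol xI (lt_le_trans sl0 slx).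
Qed.

(** A gap [u sl < sl] would leave room to continue the solution below [sl],
giving a smaller admissible speed. *)
Lemma velocity_at_limit_speed : u sl = sl.
Proof.
have [cr cu _] := solution_continuous hgu hrho0 hp0 hsp sol (lexx sl).
have cid := @within_continuous_id R `[sl, sp].
have usl : u sl <= sl.
  rewrite leNgt; apply/negP => slu.
  have usp : u sp < sp by apply: velocity_lt; rewrite slsp lexx.
  have [||c] := @IVT R (id - u) sl sp 0 (ltW slsp).
  - exact: within_continuousB.
  - by rewrite !fctE ge_min subr_le0 (ltW slu)/= le_max !subr_ge0 (ltW usp) orbT.
  rewrite in_itv/= => /andP[slc csp]; rewrite fctE => /subr0_eq cuc.
  move: slc; rewrite le_eqVlt => /predU1P[slc|slc].
    by move: slu; rewrite slc -cuc ltxx.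
  by have := @velocity_lt c; rewrite slc csp -cuc ltxx => /(_ isT).
apply/eqP; rewrite eq_le usl leNgt; apply/negP => usl'.
have [s' [r' [u' [s'0 s'sl sol' u'b eqs]]]] :=
  solution_extends hgu hrho0 hp0 hsp sol sl0 (ltW slsp) usl'.
suff /sl_lb : admissible_speeds gu rho0 p0 sp s' by rewrite leNgt s'sl.
split; first by rewrite ltW//= (lt_trans s'sl).
exists r', u'; split=> // x xI; have [_ r'0 _ _ _] := sol'; split; last exact: r'0.
move: xI => /andP[s'x xsp]; have [xsl|slx] := leP x sl; first by apply: u'b; rewrite s'x.
have xI : sl <= x <= sp by rewrite (ltW slx).
have [_ ->] := eqs _ xI.
have [_ ux0] := solution_gt0 hgu hrho0 hp0 hsp sol xI (lt_trans sl0 slx).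
by rewrite !ltW// velocity_lt// slx.
Qed.

End limit_speed.

(** * The reaction balance *)

Section reaction_balance.
Variables (R : realType) (gu gb Q rho0 p0 sp sl : R) (r u : R -> R).
Hypotheses (hgu : 1 < gu) (hgb : 1 < gb) (hrho0 : 0 < rho0) (hp0 : 0 < p0).
Hypothesis hsp : sound_speed0 gu rho0 p0 < sp.
Hypothesis hsl : infimums (admissible_speeds gu rho0 p0 sp) sl.
Hypothesis sol : is_solution gu rho0 p0 sp sl r u.

Local Notation F := (Fr gu gb Q rho0 p0 sp r u).

Let sl0 : 0 < sl.
Proof. by have /andP[] := limit_speed_itv hgu hrho0 hp0 hsp hsl. Qed.
Let slsp : sl < sp.
Proof. by have /andP[] := limit_speed_itv hgu hrho0 hp0 hsp hsl. Qed.
Let r_gt0 x : sl <= x <= sp -> 0 < r x.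
Proof. exact: (solution_density_gt0 hgu hrho0 hp0 hsp hsl sol). Qed.
Let u_lt x : sl < x <= sp -> u x < x.
Proof. exact: (velocity_lt hgu hrho0 hp0 hsp hsl sol). Qed.

Lemma Fr_C1 : C1_on `]sl, sp] F.
Proof.
have sub : `]sl, sp] `<=` [set x : R | sl <= x <= sp /\ 0 < x].
  move=> x; rewrite /= in_itv/= => /andP[slx xsp]; rewrite ltW//.
  by split=> //; exact: lt_trans slx.
have [_ _ _ [r' [u' [Cr' Cu' _ _]]] _] := sol.
have Cr : C1_on `]sl, sp] r by apply: C1_on_subset sub _; exists r'.
have Cu : C1_on `]sl, sp] u by apply: C1_on_subset sub _; exists u'.
have Cx := @C1_on_id R `]sl, sp].
have Cc c := @C1_on_cst R `]sl, sp] c.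
have rI x : `]sl, sp]%classic x -> 0 < r x.
  by rewrite /= in_itv/= => /andP[slx xsp]; apply: r_gt0; rewrite ltW.
have uI x : `]sl, sp]%classic x -> (id - u) x != 0.
  by rewrite /= in_itv/= => /u_lt ux; rewrite fctE gt_eqF// subr_gt0.
have Cxu : C1_on `]sl, sp] (fun x => ((id - u) x)^-1).
  by apply: C1_onV uI _; apply: C1_onD Cx _; exact: C1_onN.
have Cp : C1_on `]sl, sp] (fun x => s1 gu rho0 p0 sp * r x `^ gu * (r x)^-1).
  apply: C1_onM; first by apply: (C1_onM (Cc _)); exact: C1_on_powR.
  by apply: C1_onV => // x /rI; rewrite lt0r => /andP[].
have -> : F = (((fun=> 2^-1) * (u * u) + (fun=> (gb - 1)^-1) * id * u)
    + ((fun=> gu / (gu - 1)) + - ((fun=> gb / (gb - 1)) *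
         (id * (fun x => ((id - u) x)^-1))))
      * (fun x => s1 gu rho0 p0 sp * r x `^ gu * (r x)^-1)) + (fun=> Q).
  by apply/funext => x; rewrite /Fr /pressure !fctE expr2.
apply: C1_onD => //; apply: C1_onD; last first.
  apply: C1_onM => //; apply: C1_onD => //; apply: C1_onN.
  by apply: C1_onM => //; exact: C1_onM.
by apply: C1_onD; apply: C1_onM => //; exact: C1_onM.
Qed.

(** [Fr] is [G - H / (x - u)] with [G] bounded and [H] bounded below by a
positive constant up to [sl], while [x - u] tends to 0. *)
Lemma Fr_limit_speed : F x @[x --> sl^'+] --> -oo%R.
Proof.
have [cr cu _] := solution_continuous hgu hrho0 hp0 hsp sol (lexx sl).
have cid := @within_continuous_id R `[sl, sp].
have cc c := @within_continuous_cst R `[sl, sp] c.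
pose q x := s1 gu rho0 p0 sp * r x `^ gu * (r x)^-1.
have rI x : `[sl, sp]%classic x -> 0 < r x by rewrite /= in_itv/= => /r_gt0.
have cq : {within `[sl, sp], continuous q}.
  apply: within_continuousM; last first.
    by apply: within_continuousV => // x /rI; rewrite lt0r => /andP[].
  apply: within_continuousM => //.
  apply: within_continuous_powR => //; first exact: lt_trans hgu.
  by move=> x /rI /ltW.
pose G x := 2^-1 * (u x * u x) + (gb - 1)^-1 * x * u x + gu / (gu - 1) * q x + Q.
have [K GK] : exists K, forall x, sl <= x <= sp -> `|G x| <= K.
  apply: within_continuous_bounded; apply: within_continuousD => //.
  apply: within_continuousD; last exact: within_continuousM.
  apply: within_continuousD; apply: within_continuousM => //.
    exact: within_continuousM.
  exact: within_continuousM.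
pose H x := gb / (gb - 1) * (x * q x).
have [e [e0 He]] : exists e, 0 < e /\ forall x, sl <= x <= sp -> e <= H x.
  apply: positive_bounded_below.
    by apply: within_continuousM => //; exact: within_continuousM.
  move=> x xI; have /andP[slx _] := xI; have x0 := lt_le_trans sl0 slx.
  have rx := r_gt0 xI; have gb0 : 0 < gb by exact: lt_trans hgb.
  rewrite /H /q; apply: mulr_gt0; first by rewrite divr_gt0// subr_gt0.
  apply: mulr_gt0 => //; rewrite divr_gt0// mulr_gt0 ?powR_gt0//.
  exact: s1_gt0.
have FE x : sl < x <= sp -> F x = G x - H x / (x - u x).
  by move=> xI; rewrite /Fr /pressure /G /H /q expr2; ring.
apply/cvgrNyPlt => M.
have u0 : u x @[x --> sl^'+] --> sl.
  have [_ + _] := (continuous_within_itvP _ slsp).1 cu.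
  by rewrite (velocity_at_limit_speed hgu hrho0 hp0 hsp hsl sol).
have xu0 : x - u x @[x --> sl^'+] --> (0 : R).
  rewrite -(subrr sl); apply: cvgB => //.
  by apply: cvg_at_right_filter; exact: cvg_id.
pose d := e / (`|K| + `|M| + 1).
have d0 : 0 < d by rewrite divr_gt0// ltr_wpDl// addr_ge0.
near=> x.
have xI : sl < x <= sp.
  by apply/andP; split; [near: x; exact: nbhs_right_gt|near: x; exact: nbhs_right_le].
have xI' : sl <= x <= sp by case/andP: xI => /ltW -> ->.
have xux : x - u x < d by near: x; exact: (cvgr_lt _ xu0).
have xux0 : 0 < x - u x by rewrite subr_gt0 u_lt.
rewrite FE//.
have : `|K| + `|M| + 1 < H x / (x - u x).
  apply: (@lt_le_trans _ _ (e / (x - u x))); last by rewrite ler_pM2r ?invr_gt0// He.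
  move: xux; rewrite /d ltr_pdivlMr ?ltr_wpDl ?addr_ge0// mulrC => h.
  by rewrite ltr_pdivlMr.
have := le_trans (ler_norm _) (GK _ xI').
have := ler_norm K; have := ler_norm (- M); rewrite normrN.
by lra.
Unshelve. all: by end_near. Qed.

(** Conservation of energy across the precursor shock.  Eliminating [p0 / rho0]
by means of [density_ratioE] leaves a rational identity. *)
Lemma Fr_precursor_speed :
  F sp = Q + (gu / (gu - 1) - gb / (gb - 1)) * (p0 / rho0).
Proof.
have [_ _ _ _ [rsp usp]] := sol.
rewrite /Fr /pressure rsp usp (s1_powR hgu hrho0 hp0 hsp).
rewrite (p1_div_rho1 hgu hrho0 hp0 hsp) /u1.
have := density_ratioE hgu hrho0 hp0 hsp.
have := density_ratio_itv hgu hrho0 hp0 hsp.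
move: (rho0 / _) (p0 / rho0) => al q /andP[al0 al1] E.
have gu1 : gu - 1 != 0 by rewrite subr_eq0 gt_eqF.
have gb1 : gb - 1 != 0 by rewrite subr_eq0 gt_eqF.
have gu0 : gu != 0 by rewrite gt_eqF// (lt_trans _ hgu).
have al_neq0 : al != 0 by rewrite gt_eqF.
have sp0 : sp != 0 by rewrite gt_eqF// (lt_trans sl0).
have -> : q = (al * (gu + 1) - (gu - 1)) * sp ^+ 2 / (2 * gu).
  have -> : (al * (gu + 1) - (gu - 1)) * sp ^+ 2 = 2 * (gu * q) by rewrite mulrBl E; ring.
  by field.
have -> : sp / (sp - (1 - al) * sp) = al^-1.
  have -> : sp - (1 - al) * sp = al * sp by ring.
  by field; rewrite al_neq0.
by field; rewrite gu1 gb1 gu0.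
Qed.

Lemma Sr_closed : closed (Sr gu gb Q rho0 p0 sp sl r u : set (subspace `]sl, sp[)).
Proof.
have cF : {within `]sl, sp[, continuous F}.
  apply: continuous_subspaceW (C1_on_continuous Fr_C1).
  by apply: subset_itv; rewrite bnd_simp.
have -> : (Sr gu gb Q rho0 p0 sp sl r u : set (subspace `]sl, sp[)) =
    F @^-1` [set 0] `&` `]sl, sp[.
  by apply/seteqP; split => x /=; rewrite /Sr/= in_itv/= => -[].
apply: closedI; last exact: closed_subspaceT.
by apply: (continuous_closedP _).1 cF _ _; exact: closed_eq.
Qed.

(** Zeros cannot accumulate at [sl], where [Fr] tends to [-oo], so all of them
lie in a compact interval. *)
Lemma Sr_max : 0 < F sp ->
  exists sr, Sr gu gb Q rho0 p0 sp sl r u sr /\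
    forall x, Sr gu gb Q rho0 p0 sp sl r u x -> x <= sr.
Proof.
move=> Fsp.
have [d [d0 Fd]] : exists d, sl < d < sp /\ forall x, sl < x <= d -> F x < 0.
  have /cvgrNyPlt/(_ 0) := Fr_limit_speed.
  rewrite near_withinE => -[e /= e0 eP].
  exists (sl + Num.min e (sp - sl) / 2).
  have m0 : 0 < Num.min e (sp - sl) by rewrite lt_min e0 subr_gt0.
  have me : Num.min e (sp - sl) <= e by rewrite ge_min lexx.
  have ms : Num.min e (sp - sl) <= sp - sl by rewrite ge_min lexx orbT.
  split; first by apply/andP; split; lra.
  move=> x /andP[slx xd]; apply: eP => //=.
  by rewrite distrC gtr0_norm ?subr_gt0//; lra.
have /andP[sld dsp] := d0.
have cF : {within `[d, sp], continuous F}.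
  apply: continuous_subspaceW (C1_on_continuous Fr_C1).
  by apply: subset_itv; rewrite bnd_simp.
have [|c [/andP[dc csp] Fc cmax]] := exists_largest_zero cF (ltW dsp) _ Fsp.
  by apply: Fd; rewrite sld lexx.
exists c; split; first by rewrite /Sr/= (lt_trans sld) ?csp.
move=> x [/andP[slx xsp] Fx]; have [xd|dx] := leP x d.
  by have := Fd x; rewrite slx xd Fx ltxx => /(_ isT).
by apply: cmax => //; rewrite !ltW.
Qed.

End reaction_balance.

Unset Implicit Arguments.

Theorem lemma2p4 (R : realType) (gu gb Q rho0 p0 sp sl : R) (r u : R -> R)
  (hgu : 1 < gu) (hgb : 1 < gb) (hQ : 0 < Q) (hrho0 : 0 < rho0) (hp0 : 0 < p0)
  (hsp : sound_speed0 gu rho0 p0 < sp)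
  (hsl : infimums (admissible_speeds gu rho0 p0 sp) sl)
  (hsol : is_solution gu rho0 p0 sp sl r u) :
  [/\ forall x, sl < x <= sp -> x - u x != 0 /\ r x != 0,
      C1_on `]sl, sp] (Fr gu gb Q rho0 p0 sp r u),
      Fr gu gb Q rho0 p0 sp r u x @[x --> sl^'+] --> -oo%R
    & closed (Sr gu gb Q rho0 p0 sp sl r u : set (subspace `]sl, sp[))] /\
  (* [Fr] at [sp] equals the left-hand side below, which [0 < Q] alone does
     not make positive. *)
  (0 < Q + (gu / (gu - 1) - gb / (gb - 1)) * (p0 / rho0) ->
   [/\ 0 < Fr gu gb Q rho0 p0 sp r u sp,
       Sr gu gb Q rho0 p0 sp sl r u !=set0
     & exists sr : R, Sr gu gb Q rho0 p0 sp sl r u sr /\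
         forall x, Sr gu gb Q rho0 p0 sp sl r u x -> x <= sr]).
Proof.
split; first split.
- move=> x xI; split.
    by rewrite gt_eqF// subr_gt0 (velocity_lt hgu hrho0 hp0 hsp hsl hsol).
  rewrite gt_eqF// (solution_density_gt0 hgu hrho0 hp0 hsp hsl hsol)//.
  by case/andP: xI => /ltW -> ->.
- exact: Fr_C1.
- exact: Fr_limit_speed.
- exact: Sr_closed.
rewrite -(Fr_precursor_speed Q hgu hgb hrho0 hp0 hsp hsl hsol) => Fsp.
have [sr [Ssr max]] := Sr_max hgu hgb hrho0 hp0 hsp hsl hsol Fsp.
by split => //; exists sr.
Qed.
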